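(* Let $\lambda>0$ be such that $\|H_a\|\le\lambda$ and $\|V_a\|^2\le\lambda$ for every $a\in\mathcal A$. For all constants $c_0,C_0>0$ there is a constant $C>0$, depending only on $c_0$ and $C_0$, such that the following holds. If $0<\tau\le c_0\lambda^{-1}$, if $$\|\mathcal F_\tau(\mathcal L_a)-e^{\tau\mathcal L_a}\|_\diamond\le C_0\lambda^2\tau^2\qquad\text{for all }a\in\mathcal A,$$ and if $T=\tau M$ with $M\ge1$ an integer, then for every quantum state $\rho$ on $\mathcal H$ and every observable $O\in\mathcal B(\mathcal H)$, $$\Big|\mathbb E\,\langle O\rangle_{\mathcal E_{\tau,M}(\rho)}-\langle O\rangle_{e^{T\bar{\mathcal L}}(\rho)}\Big|\le C\,\|O\|\,\frac{\lambda^2T^2}{M}.$$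
   Context: $\mathcal H$ is a Hilbert space of finite dimension $N=2^n$, $\mathcal B(\mathcal H)$ is the space of operators on it, $\|\cdot\|$ is the spectral norm, $\|X\|_1=\operatorname{Tr}\sqrt{X^\dagger X}$. A quantum state is a positive semidefinite operator of trace one; a quantum channel is a completely positive trace-preserving linear map on $\mathcal B(\mathcal H)$. An observable is a Hermitian operator, and $\langle O\rangle_\rho=\operatorname{Tr}(O\rho)$. For a linear map $\Phi$ on $\mathcal B(\mathcal H)$, $\|\Phi\|_\diamond=\sup\{\|(\Phi\otimes\mathrm{id})X\|_1: X\in\mathcal B(\mathcal H\otimes\mathcal H),\ \|X\|_1=1\}$. $(\mathcal A,\mu)$ is a probability space. For each $a\in\mathcal A$, $H_a\in\mathcal B(\mathcal H)$ is Hermitian, $V_a\in\mathcal B(\mathcal H)$, and $$\mathcal L_a(\rho)=-i[H_a,\rho]+V_a\rho V_a^\dagger-\tfrac12\{V_a^\dagger V_a,\rho\},$$ with measurable dependence on $a$. Set $\bar{\mathcal L}=\int_{\mathcal A}\mathcal L_a\,d\mu(a)$. For each $a$, $\mathcal F_\tau(\mathcal L_a)$ is a quantum channel (depending measurably on $a$), thought of as an algorithmic approximation of $e^{\tau\mathcal L_a}$. The random channel is $\mathcal E_{\tau,M}=\mathcal F_\tau(\mathcal L_{a_M})\cdots\mathcal F_\tau(\mathcal L_{a_1})$ with $a_1,\dots,a_M$ independent samples from $\mu$; $\mathbb E$ is the expectation over these samples. *)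

(* Defs.v *)
From HB Require Import structures.
From mathcomp Require Import all_boot all_order all_algebra.
From mathcomp Require Import spectral sesquilinear.
From mathcomp Require Import all_classical all_reals all_analysis.
From mathcomp.real_closed Require Import complex mxtens.
Set Implicit Arguments.
Unset Strict Implicit.
Unset Printing Implicit Defensive.
Import Order.TTheory GRing.Theory Num.Theory.
Import numFieldNormedType.Exports.
Local Open Scope classical_set_scope.
Local Open Scope ring_scope.
Local Open Scope complex_scope.
Local Open Scope sesquilinear_scope.

(* Operators on C^N, and maps on operators. Linearity is not built into
   [superop]; it is part of [quantum_channel]. *)
Notation op R N := 'M[R[i]]_N.
Definition superop (R : realType) (N : nat) : Type := op R N -> op R N.

Definition vnorm (R : realType) (N : nat) (v : 'cV[R[i]]_N) : R :=
  Num.sqrt (\sum_(i < N) Normc.normc (v i 0) ^+ 2).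

Definition spectral_norm (R : realType) (N : nat) (X : op R N) : R :=
  sup [set vnorm (X *m v) | v in [set v : 'cV[R[i]]_N | vnorm v = 1]].

(* Functional calculus: the spectral decomposition is
   A = invmx U *m diag_mx d *m U with U := spectralmx A unitary, for normal A. *)
Definition sqrtmx (R : realType) (N : nat) (A : op R N) : op R N :=
  invmx (spectralmx A) *m diag_mx (map_mx sqrtC (spectral_diag A))
    *m spectralmx A.

(* The trace is a nonnegative real; complex.Re only changes its type. *)
Definition trace_norm (R : realType) (N : nat) (X : op R N) : R :=
  complex.Re (\tr (sqrtmx (X^t* *m X))).

(* The comparison in R[i] forces the quadratic form to be real, so psd
   operators are in particular Hermitian. *)
Definition psd (R : realType) (N : nat) (X : op R N) : Prop :=
  forall v : 'cV[R[i]]_N, 0 <= (v^t* *m X *m v) 0 0.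

Definition quantum_state (R : realType) (N : nat) (rho : op R N) : Prop :=
  psd rho /\ \tr rho = 1.

(* X = \sum_(k, l) tens_block X k l *t delta_mx k l *)
Definition tens_block (R : realType) (N m : nat) (X : op R (N * m)) (k l : 'I_m) :
    op R N :=
  \matrix_(i, j) X (mxtens_index (i, k)) (mxtens_index (j, l)).

(* Phi (x) id, the linear extension of A *t B |-> Phi A *t B; the ancilla C^m
   is the second tensor factor. *)
Definition tens_id (R : realType) (N m : nat) (Phi : superop R N) :
    superop R (N * m) :=
  fun X => \sum_(k < m) \sum_(l < m) (Phi (tens_block X k l) *t delta_mx k l).

Definition completely_positive (R : realType) (N : nat) (Phi : superop R N) :
    Prop :=
  forall (m : nat) (X : op R (N * m)), psd X -> psd (tens_id Phi X).

Definition quantum_channel (R : realType) (N : nat) (Phi : superop R N) :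
    Prop :=
  [/\ linear Phi, completely_positive Phi & forall X, \tr (Phi X) = \tr X].

Definition diamond_norm (R : realType) (N : nat) (Phi : superop R N) : R :=
  sup [set trace_norm (tens_id Phi X) |
       X in [set X : op R (N * N) | trace_norm X = 1]].

(* exp(t Phi), as the entrywise limit of its partial sums; the real and
   imaginary parts of each entry are limits of real sequences. *)
Definition exp_psum (R : realType) (N : nat) (t : R) (Phi : superop R N)
    (X : op R N) (m : nat) : op R N :=
  \sum_(k < m) (t ^+ k / (k`!)%:R)%:C *: iter k Phi X.

Definition exp_superop (R : realType) (N : nat) (t : R) (Phi : superop R N) :
    superop R N :=
  fun X => \matrix_(i, j)
    (limn (fun m => complex.Re (exp_psum t Phi X m i j))
     +i* limn (fun m => complex.Im (exp_psum t Phi X m i j))).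

Definition lindbladian (R : realType) (N : nat) (H V : op R N) :
    superop R N :=
  fun rho => - ('i *: (H *m rho - rho *m H)) + V *m rho *m V^t*
    - 2^-1 *: (V^t* *m V *m rho + rho *m (V^t* *m V)).

Definition expval (R : realType) (N : nat) (O rho : op R N) : R[i] :=
  \tr (O *m rho).

Definition cintegral d (T : measurableType d) (R : realType)
    (mu : {measure set T -> \bar R}) (f : T -> R[i]) : R[i] :=
  Rintegral mu setT (fun x => complex.Re (f x))
  +i* Rintegral mu setT (fun x => complex.Im (f x)).

Definition measurable_superop d (T : measurableType d) (R : realType)
    (N : nat) (G : T -> superop R N) : Prop :=
  forall (X : op R N) (i j : 'I_N),
    measurable_fun setT (fun a => complex.Re (G a X i j)) /\
    measurable_fun setT (fun a => complex.Im (G a X i j)).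

Definition avg_superop d (T : measurableType d) (R : realType)
    (mu : {measure set T -> \bar R}) (N : nat) (G : T -> superop R N) :
    superop R N :=
  fun X => \matrix_(i, j) cintegral mu (fun a => G a X i j).

Definition mutually_independent d d' (W : measurableType d)
    (T : measurableType d') (R : realType) (P : probability W R)
    (I : finType) (X : I -> {RV P >-> T}) : Prop :=
  forall (J : {set I}) (B : I -> set T), (forall i, measurable (B i)) ->
    P (\bigcap_(i in [set` J]) (X i @^-1` B i))
    = (\prod_(i in J) P (X i @^-1` B i))%E.

Definition iid_samples d d' (W : measurableType d) (T : measurableType d')
    (R : realType) (P : probability W R) (mu : probability T R)
    (I : finType) (X : I -> {RV P >-> T}) : Prop :=
  mutually_independent X /\
  forall (i : I) (B : set T), measurable B -> distribution P (X i) B = mu B.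

(* The head of the list acts first: for s = [:: a_1; ...; a_M] this is
   G a_M \o ... \o G a_1. *)
Definition compose_path (T : Type) (R : realType) (N : nat)
    (G : T -> superop R N) (s : seq T) : superop R N :=
  fun rho => foldl (fun sigma a => G a sigma) rho s.

(* Main.v *)
Require Import Defs.
From HB Require Import structures.
From mathcomp Require Import all_boot all_order all_algebra.
From mathcomp Require Import spectral sesquilinear.
From mathcomp Require Import all_classical all_reals all_analysis.
From mathcomp.real_closed Require Import complex mxtens.
From mathcomp Require Import measurable_realfun ring lra.
Set Implicit Arguments.
Unset Strict Implicit.
Unset Printing Implicit Defensive.
Import Order.TTheory GRing.Theory Num.Theory.
Import numFieldNormedType.Exports.
Local Open Scope classical_set_scope.
Local Open Scope ring_scope.
Local Open Scope complex_scope.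
Local Open Scope sesquilinear_scope.

(* Idea. Independence turns the expectation of the random channel into the M-th
   power of the averaged channel Fbar = E[F_tau(L_a)]. On states, both Fbar and
   exp(tau Lbar) agree with 1 + tau Lbar up to O(lambda^2 tau^2) in trace norm, the
   former because each F_tau(L_a) is close to exp(tau L_a) and Taylor's remainder is
   averaged over a. A telescoping sum of M such errors gives M lambda^2 tau^2 =
   lambda^2 T^2 / M, provided the second factor of the telescoping sum does not blow
   up. Contractivity of exp(t Lbar) is not needed: 1 + s Lbar increases the trace norm
   by at most a factor 1 + 5 s^2 lambda^2, so the Euler scheme (1 + (tau/p) Lbar)^(pM)
   has norm at most e for p large, and it converges to exp(T Lbar) as p tends to
   infinity. All trace-norm estimates are made by duality with the operator norm. *)

(** Why Euler steps almost contract: with G = iH + V^t* V / 2 and K = 1 - sG, the dual of 1 + s L_a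
    is A |-> K^t* A K + s V^t* A V - s^2 G^t* A G. Since G + G^t* = V^t* V, the terms of first order
    in s cancel in |K u|^2 + s |V u|^2, leaving |u|^2 + s^2 |G u|^2, so only second-order growth
    remains. This is recorded as a property of the map, because an average of generators with one
    jump operator each need not have that form again. The channel errors are known on states only.
    The telescoping sum is therefore arranged so that the one-step difference always acts on a
    state, while the Euler scheme, controlled on all operators, carries the differences forward.
    Testing against a fixed operator commutes with sums, integrals and entrywise limits, which is
    what makes the dual form of the trace norm convenient. Bounds depending on the dimension serve
    only to make suprema and integrals meaningful; they never enter the constant. *)

Local Notation normc := Normc.normc.

(** * Moduli of complex numbers *)

Section ComplexModulus.
Context {R : realType}.
Implicit Types (z w : R[i]) (x : R).

Lemma normc_normr z : `|z| = (normc z)%:C.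
Proof. by []. Qed.

Lemma normc_ge0 z : 0 <= normc z.
Proof. by rewrite -lecR -normc_normr normr_ge0. Qed.

Lemma normcR x : normc x%:C = `|x|.
Proof. by rewrite /= expr0n addr0 sqrtr_sqr. Qed.

Lemma normc_conj z : normc (Num.conj z) = normc z.
Proof. by apply: complexI; rewrite -!normc_normr norm_conjC. Qed.

Lemma normc_sum (I : finType) (f : I -> R[i]) :
  normc (\sum_i f i) <= \sum_i normc (f i).
Proof.
elim/big_ind2: _ => [|a b c d ab cd|//]; first by rewrite Normc.normc0.
by apply: le_trans (le_normcD _ _) _; rewrite lerD.
Qed.

Lemma normc_sqr z : (normc z ^+ 2)%:C = Num.conj z * z.
Proof. by rewrite rmorphXn /= -normc_normr mulrC; exact: sqr_normc. Qed.

Lemma ler_normcRe z : `|complex.Re z| <= normc z.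
Proof. by rewrite -lecR; exact: normc_ge_Re. Qed.

Lemma ler_normcIm z : `|complex.Im z| <= normc z.
Proof.
case: z => a b; rewrite /= -sqrtr_sqr ler_sqrt ?addr_ge0 ?sqr_ge0//.
by rewrite lerDr sqr_ge0.
Qed.

Lemma normc_ReIm z : normc z <= `|complex.Re z| + `|complex.Im z|.
Proof.
rewrite {1}(complexE z); apply: le_trans (le_normcD _ _) _.
by rewrite Normc.normcM !normcR /= expr0n expr1n add0r sqrtr1 mul1r.
Qed.

Lemma le_normcB z w : normc (z - w) <= normc z + normc w.
Proof. by apply: le_trans (le_normcD _ _) _; rewrite normcN. Qed.

(** Rotating by this phase turns the modulus of an integral into the integral of a real part, with
    no loss of a constant. *)
Lemma unimodular_normc z :
  exists2 u : R[i], normc u = 1 & u * z = (normc z)%:C.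
Proof.
have [->|z0] := eqVneq z 0.
  by exists 1; rewrite ?Normc.normc1 ?mul1r ?Normc.normc0.
have nz : normc z != 0 by apply: contra z0 => /eqP/Normc.eq0_normc ->.
exists ((normc z)^-1%:C * Num.conj z).
  by rewrite Normc.normcM normc_conj normcR ger0_norm ?invr_ge0 ?normc_ge0 ?mulVf.
by rewrite -mulrA -normc_sqr -rmorphM /= expr2 mulKf.
Qed.

End ComplexModulus.

(** * Inner products and squared norms of vectors *)

HB.lock Definition dot {R : realType} {N} (u v : 'cV[R[i]]_N) : R[i] :=
  (u^t* *m v) 0 0.

(** The square of [vnorm]: inequalities between squared norms are polynomial, hence within reach of
    [nra]. *)
HB.lock Definition sqn {R : realType} {N} (u : 'cV[R[i]]_N) : R :=
  \sum_(i < N) normc (u i 0) ^+ 2.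

Section Vectors.
Context {R : realType}.

Lemma dotdef N (u v : 'cV[R[i]]_N) : dot u v = (u^t* *m v) 0 0.
Proof. by rewrite dot.unlock. Qed.

Lemma dotE N (u v : 'cV[R[i]]_N) : dot u v = \sum_i Num.conj (u i 0) * v i 0.
Proof. by rewrite !dotdef mxE; apply: eq_bigr => i _; rewrite !mxE. Qed.

Lemma adjE m n (A : 'M[R[i]]_(m, n)) i j : (A^t*) i j = Num.conj (A j i).
Proof. by rewrite !mxE. Qed.

Lemma adjM m n p (A : 'M[R[i]]_(m, n)) (B : 'M[R[i]]_(n, p)) :
  (A *m B)^t* = B^t* *m A^t*.
Proof. by rewrite trmx_mul map_mxM. Qed.

Lemma adjD m n (A B : 'M[R[i]]_(m, n)) : (A + B)^t* = A^t* + B^t*.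
Proof. by apply/matrixP => i j; rewrite !mxE rmorphD. Qed.

Lemma adjN m n (A : 'M[R[i]]_(m, n)) : (- A)^t* = - A^t*.
Proof. by apply/matrixP => i j; rewrite !mxE rmorphN. Qed.

Lemma adjZ m n a (A : 'M[R[i]]_(m, n)) : (a *: A)^t* = Num.conj a *: A^t*.
Proof. by apply/matrixP => i j; rewrite !mxE rmorphM. Qed.

Lemma adj1 n : (1%:M : 'M[R[i]]_n)^t* = 1%:M.
Proof. by rewrite trmx1 map_mx1. Qed.

Lemma dotMl m n (A : 'M[R[i]]_(m, n)) u v : dot (A *m u) v = dot u (A^t* *m v).
Proof. by rewrite !dotdef adjM mulmxA. Qed.

Lemma dot0r N (u : 'cV[R[i]]_N) : dot u 0 = 0.
Proof. by rewrite !dotdef mulmx0 mxE. Qed.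

Lemma dotDl N (u v w : 'cV[R[i]]_N) : dot (u + v) w = dot u w + dot v w.
Proof. by rewrite !dotdef adjD mulmxDl mxE. Qed.

Lemma dotDr N (u v w : 'cV[R[i]]_N) : dot u (v + w) = dot u v + dot u w.
Proof. by rewrite !dotdef mulmxDr mxE. Qed.

Lemma dotNl N (u v : 'cV[R[i]]_N) : dot (- u) v = - dot u v.
Proof. by rewrite !dotdef adjN mulNmx mxE. Qed.

Lemma dotNr N (u v : 'cV[R[i]]_N) : dot u (- v) = - dot u v.
Proof. by rewrite !dotdef mulmxN mxE. Qed.

Lemma dotZl N a (u v : 'cV[R[i]]_N) : dot (a *: u) v = Num.conj a * dot u v.
Proof. by rewrite !dotdef adjZ -scalemxAl mxE. Qed.

Lemma dotZr N a (u v : 'cV[R[i]]_N) : dot u (a *: v) = a * dot u v.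
Proof. by rewrite !dotdef -scalemxAr mxE. Qed.

Lemma dot_conj N (u v : 'cV[R[i]]_N) : Num.conj (dot u v) = dot v u.
Proof.
rewrite !dotE rmorph_sum; apply: eq_bigr => i _.
by rewrite rmorphM /= conjCK mulrC.
Qed.

Lemma sqn_ge0 N (u : 'cV[R[i]]_N) : 0 <= sqn u.
Proof.
by rewrite sqn.unlock; apply: sumr_ge0 => i _; rewrite exprn_ge0 ?normc_ge0.
Qed.

Lemma dotuu N (u : 'cV[R[i]]_N) : dot u u = (sqn u)%:C.
Proof.
by rewrite dotE sqn.unlock rmorph_sum; apply: eq_bigr => i _; rewrite /= -normc_sqr.
Qed.

Lemma vnormE N (u : 'cV[R[i]]_N) : vnorm u = Num.sqrt (sqn u).
Proof. by rewrite sqn.unlock. Qed.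

Lemma sqn_eq0 N (u : 'cV[R[i]]_N) : sqn u = 0 -> u = 0.
Proof.
rewrite sqn.unlock => /eqP; rewrite psumr_eq0 => [/allP u0|i _]; last by rewrite exprn_ge0 ?normc_ge0.
apply/colP => i; rewrite mxE; apply: Normc.eq0_normc; apply/eqP.
by have := u0 i; rewrite mem_index_enum sqrf_eq0 /= => ->.
Qed.

Lemma sqnZ N a (u : 'cV[R[i]]_N) : sqn (a *: u) = normc a ^+ 2 * sqn u.
Proof.
by rewrite sqn.unlock mulr_sumr; apply: eq_bigr => i _; rewrite mxE Normc.normcM exprMn.
Qed.

Lemma sqn0 N : sqn (0 : 'cV[R[i]]_N) = 0.
Proof. by rewrite -(scale0r 0) sqnZ Normc.normc0 expr0n mul0r. Qed.

(** A termwise arithmetic-geometric inequality; applied to a rescaled [u] it replaces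
    Cauchy-Schwarz. *)
Lemma normc_dot N (u v : 'cV[R[i]]_N) : normc (dot u v) <= (sqn u + sqn v) / 2.
Proof.
rewrite dotE; apply: le_trans (normc_sum _) _.
rewrite !sqn.unlock -big_split /= mulr_suml; apply: ler_sum => i _.
rewrite Normc.normcM normc_conj.
have := sqr_ge0 (normc (u i 0) - normc (v i 0)).
by move: (normc _) (normc _) => x y; nra.
Qed.

Lemma sqnD N (u v : 'cV[R[i]]_N) : sqn (u + v) <= 2 * sqn u + 2 * sqn v.
Proof.
rewrite sqn.unlock !mulr_sumr -big_split /=; apply: ler_sum => i _.
rewrite mxE.
have := le_normcD (u i 0) (v i 0); have := normc_ge0 (u i 0 + v i 0).
have := sqr_ge0 (normc (u i 0) - normc (v i 0)).
have := normc_ge0 (u i 0); have := normc_ge0 (v i 0).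
by move: (normc _) (normc _) (normc _) => x y z; nra.
Qed.

(** With w = V^t* u one has |w|^2 = <u, V w>; weighting [u] by [l] in [normc_dot] gives l |w|^2 <=
    (l^2 |u|^2 + l |w|^2) / 2. *)
Lemma sqn_adj N (V : op R N) l : 0 <= l ->
  (forall u, sqn (V *m u) <= l * sqn u) -> forall u, sqn (V^t* *m u) <= l * sqn u.
Proof.
move=> l0 hV u.
(* The estimate comes with a spare factor [l]. If [l = 0] it cannot be cancelled, but then V
   vanishes. *)
suff : l * sqn (V^t* *m u) <= l * (l * sqn u).
  have [l00|ln0] := eqVneq l 0; last by rewrite ler_pM2l // lt_neqAle eq_sym ln0.
  move=> _; rewrite l00 mul0r.
  suff -> : V^t* *m u = 0 by rewrite sqn0.
  have V0 (w : 'cV_N) : V *m w = 0.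
    by apply: sqn_eq0; apply/eqP; rewrite eq_le sqn_ge0 andbT -[leRHS](mul0r (sqn w)) -l00 hV.
  apply: sqn_eq0; apply: complexI; rewrite -dotuu dotMl trmxCK V0.
  by rewrite dot0r.
set w := V^t* *m u.
have e : (sqn w)%:C = dot u (V *m w) by rewrite -dotuu {1}/w dotMl trmxCK.
have h : l * sqn w <= (l ^+ 2 * sqn u + sqn (V *m w)) / 2.
  have := normc_dot (l%:C *: u) (V *m w).
  rewrite dotZl sqnZ -e Normc.normcM normc_conj !normcR !ger0_norm ?sqn_ge0 //.
have := hV w; nra.
Qed.

End Vectors.

(** * Operator-norm bounds and their dual trace-norm bounds *)

Section OperatorBounds.
Context {R : realType}.

(* [opbnd A b] says that b bounds the spectral norm of A. The quadratic form of
   the right-hand side is equivalent to [sqrt (sqn u * sqn v)] by scaling, and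
   avoids square roots. *)
Definition opbnd N (A : op R N) (b : R) : Prop :=
  forall u v, normc (dot u (A *m v)) <= b * ((sqn u + sqn v) / 2).

(* [trbnd X c] says that c bounds the trace norm of X, the dual norm. *)
Definition trbnd N (X : op R N) (c : R) : Prop :=
  forall A b, 0 <= b -> opbnd A b -> normc (\tr (A *m X)) <= b * c.

(** A crude bound, entries of a unit vector having modulus at most one. It shows that suprema are
    taken over bounded sets, where [sup] is meaningful. *)
Lemma vnorm_mulmx_le N (X : op R N) v : vnorm v = 1 ->
  vnorm (X *m v) <= Num.sqrt (\sum_i (\sum_j normc (X i j)) ^+ 2).
Proof.
move=> v1; rewrite /vnorm ler_sqrt; last by apply: sumr_ge0 => i _; exact: sqr_ge0.
apply: ler_sum => i _; rewrite lerXn2r ?nnegrE ?normc_ge0 //.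
  by apply: sumr_ge0 => j _; exact: normc_ge0.
rewrite mxE; apply: le_trans (normc_sum _) _; apply: ler_sum => j _.
rewrite Normc.normcM ler_piMr ?normc_ge0 //.
rewrite -v1 vnormE -[leLHS](@ger0_norm _ _) ?normc_ge0 // -sqrtr_sqr ler_sqrt ?sqn_ge0 // sqn.unlock.
rewrite (bigD1 j) //= lerDl; apply: sumr_ge0 => k _; exact: sqr_ge0.
Qed.

Lemma has_ubound_spectral N (X : op R N) :
  has_ubound [set vnorm (X *m v) | v in [set v : 'cV[R[i]]_N | vnorm v = 1]].
Proof. by eexists => _ [v /= v1 <-]; exact: vnorm_mulmx_le. Qed.

Lemma spectral_norm_ge0 N (X : op R N) : 0 <= spectral_norm X.
Proof.
have [/set0P[y [v v1 yE]]|/negPn/eqP] := boolP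
    ([set vnorm (X *m v) | v in [set v : 'cV[R[i]]_N | vnorm v = 1]] != set0).
  apply: (@le_trans _ _ (vnorm (X *m v))); first exact: sqrtr_ge0.
  by apply: ub_le_sup; [exact: has_ubound_spectral|exists v].
(* Without unit vectors, in dimension zero, the [sup] of the empty set is 0 by convention. *)
by rewrite /spectral_norm => ->; rewrite sup0.
Qed.

Lemma sqn_spectral N (X : op R N) v : sqn (X *m v) <= spectral_norm X ^+ 2 * sqn v.
Proof.
have [v0|v0] := eqVneq (sqn v) 0.
  by rewrite (sqn_eq0 v0) mulmx0 sqn0 mulr0.
have p : 0 < sqn v by rewrite lt_neqAle eq_sym v0 sqn_ge0.
have ps : 0 < Num.sqrt (sqn v) by rewrite sqrtr_gt0.
pose w := (Num.sqrt (sqn v))^-1%:C *: v.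
have w1 : vnorm w = 1.
  rewrite vnormE sqnZ normcR ger0_norm ?invr_ge0 ?sqrtr_ge0//.
  by rewrite exprVn sqr_sqrtr ?(ltW p) // mulVf // sqrtr1.
have : vnorm (X *m w) <= spectral_norm X.
  by apply: ub_le_sup; [exact: has_ubound_spectral|exists w].
rewrite vnormE -scalemxAr sqnZ normcR ger0_norm ?invr_ge0 ?sqrtr_ge0//.
rewrite exprVn sqr_sqrtr ?(ltW p) // => h.
have : Num.sqrt ((sqn v)^-1 * sqn (X *m v)) ^+ 2 <= spectral_norm X ^+ 2.
  by rewrite lerXn2r ?nnegrE ?sqrtr_ge0 ?spectral_norm_ge0.
rewrite sqr_sqrtr; last by rewrite mulr_ge0 ?sqn_ge0 ?invr_ge0 ?(ltW p).
by move=> h'; rewrite -ler_pdivrMr // mulrC.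
Qed.

(** b <u, A v> is the inner product of b u and A v, whose squared norms both carry a factor b^2 in
    their bounds; one b then cancels in [normc_dot]. *)
Lemma opbnd_sqn N (A : op R N) b : 0 <= b ->
  (forall v, sqn (A *m v) <= b ^+ 2 * sqn v) -> opbnd A b.
Proof.
move=> b0 hA u v; have hv := hA v.
have [b00|bn0] := eqVneq b 0.
  move: hv; rewrite b00 expr0n !mul0r => hv.
  suff -> : A *m v = 0 by rewrite dot0r Normc.normc0.
  by apply: sqn_eq0; apply/eqP; rewrite eq_le hv sqn_ge0.
have bp : 0 < b by rewrite lt_neqAle eq_sym bn0.
rewrite -(ler_pM2l bp).
have := normc_dot (b%:C *: u) (A *m v).
rewrite dotZl sqnZ Normc.normcM normc_conj !normcR ger0_norm //.
move/le_trans; apply; nra.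
Qed.

Lemma opbnd_spectral N (A : op R N) : opbnd A (spectral_norm A).
Proof. by apply: opbnd_sqn (sqn_spectral A); exact: spectral_norm_ge0. Qed.

Lemma opbnd_sqrt N (A : op R N) b u v : opbnd A b -> sqn u = 1 ->
  normc (dot u (A *m v)) <= b * Num.sqrt (sqn v).
Proof.
move=> hA u1; have [v0|v0] := eqVneq (sqn v) 0.
  by rewrite (sqn_eq0 v0) mulmx0 dot0r Normc.normc0 sqn0 sqrtr0 mulr0.
have p : 0 < sqn v by rewrite lt_neqAle eq_sym v0 sqn_ge0.
have ps : 0 < Num.sqrt (sqn v) by rewrite sqrtr_gt0.
have := hA u ((Num.sqrt (sqn v))^-1%:C *: v).
rewrite -scalemxAr dotZr sqnZ Normc.normcM normcR ger0_norm ?invr_ge0 ?(ltW ps) //.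
rewrite exprVn sqr_sqrtr ?(ltW p) // mulVf // u1 -[1 + 1](mulr2n 1).
by rewrite mulfV ?pnatr_eq0 // mulr1 mulrC ler_pdivrMr.
Qed.

Lemma opbnd_delta N (i j : 'I_N) : opbnd (delta_mx i j : op R N) 1.
Proof.
apply: opbnd_sqn => // v; rewrite expr1n mul1r sqn.unlock.
rewrite (bigD1 i) //= big1 ?addr0; last first.
  move=> k ki; rewrite mxE big1 ?Normc.normc0 ?expr0n // => l _.
  by rewrite mxE (negbTE ki) mul0r.
rewrite mxE (bigD1 j) //= big1 ?addr0; last first.
  by move=> l lj; rewrite mxE (negbTE lj) andbF mul0r.
rewrite mxE !eqxx mul1r (bigD1 j) //= lerDl.
by apply: sumr_ge0 => k _; exact: sqr_ge0.
Qed.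

Lemma mxtrace_delta N (i j : 'I_N) (X : op R N) : \tr (delta_mx i j *m X) = X j i.
Proof.
rewrite /mxtrace (bigD1 i) //= big1 ?addr0; last first.
  move=> k ki; rewrite mxE big1 // => l _.
  by rewrite mxE (negbTE ki) mul0r.
rewrite mxE (bigD1 j) //= big1 ?addr0; last first.
  by move=> l lj; rewrite mxE (negbTE lj) andbF mul0r.
by rewrite mxE !eqxx mul1r.
Qed.

(** Entries are traces against matrix units, which have norm at most one. This links trace bounds to
    entrywise limits and integrals. *)
Lemma trbnd_entry N (X : op R N) c i j : trbnd X c -> normc (X i j) <= c.
Proof.
by move=> /(_ _ _ ler01 (opbnd_delta j i)); rewrite mxtrace_delta mul1r.
Qed.

Lemma trbnd_ge0 N (X : op R N) c : trbnd X c -> 0 <= c.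
Proof.
move=> /(_ 0 1 ler01); rewrite mul1r => h.
apply: le_trans (h _); first exact: normc_ge0.
move=> u v; rewrite mul0mx dot0r Normc.normc0 mul1r.
by rewrite divr_ge0 // addr_ge0 ?sqn_ge0.
Qed.

Lemma trbnd_le N (X : op R N) c c' : c <= c' -> trbnd X c -> trbnd X c'.
Proof. by move=> cc h A b b0 /(h _ _ b0)/le_trans; apply; exact: ler_wpM2l. Qed.

Lemma trbndD N (X Y : op R N) c c' : trbnd X c -> trbnd Y c' -> trbnd (X + Y) (c + c').
Proof.
move=> hX hY A b b0 hA; rewrite mulmxDr raddfD /= mulrDr.
by apply: le_trans (le_normcD _ _) _; apply: lerD; [exact: hX|exact: hY].
Qed.

Lemma trbndZ N (X : op R N) a c : trbnd X c -> trbnd (a *: X) (normc a * c).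
Proof.
move=> hX A b b0 hA; rewrite -scalemxAr mxtraceZ Normc.normcM mulrCA.
by rewrite ler_wpM2l ?normc_ge0 //; exact: hX.
Qed.

Lemma trbndZr N (X : op R N) (a : R) c : 0 <= a -> trbnd X c -> trbnd (a%:C *: X) (a * c).
Proof. by move=> a0 /(@trbndZ _ _ a%:C); rewrite normcR ger0_norm. Qed.

Lemma trbndN N (X : op R N) c : trbnd X c -> trbnd (- X) c.
Proof.
by move=> h A b b0 hA; rewrite mulmxN raddfN /= normcN; exact: h.
Qed.

Lemma trbnd0 N : trbnd (0 : op R N) 0.
Proof. by move=> A b b0 _; rewrite mulmx0 mxtrace0 Normc.normc0 mulr0. Qed.

Lemma trbnd_sum N (I : Type) (s : seq I) (X : I -> op R N) c :
  (forall i, trbnd (X i) (c i)) -> trbnd (\sum_(i <- s) X i) (\sum_(i <- s) c i).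
Proof.
move=> h; elim/big_ind2: _ => // [|X1 c1 X2 c2]; first exact: trbnd0.
exact: trbndD.
Qed.

End OperatorBounds.

(** * Singular vectors, the trace norm and positive operators *)

Section TraceNorm.
Context {R : realType}.

Lemma sqrtC_real (x : R) : 0 <= x -> sqrtC x%:C = (Num.sqrt x)%:C :> R[i].
Proof.
move=> x0; rewrite -{1}(sqr_sqrtr x0) rmorphXn /= sqrCK //.
by rewrite ler0c sqrtr_ge0.
Qed.

(* The u i are right singular vectors of X. *)
Lemma trace_norm_singular N (X : op R N) :
  exists u : 'I_N -> 'cV[R[i]]_N,
  [/\ forall i, sqn (u i) = 1,
      forall A : op R N, \tr A = \sum_i dot (u i) (A *m u i),
      forall i, X^t* *m (X *m u i) = (sqn (X *m u i))%:C *: u i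
    & trace_norm X = \sum_i vnorm (X *m u i)].
Proof.
set S := X^t* *m X; pose U := spectralmx S; pose d := spectral_diag S.
have hS : S^t* = S by rewrite /S adjM trmxCK.
have Sn : S \is normalmx by apply/normalmxP; rewrite hS.
have UU : U *m U^t* = 1%:M by apply/unitarymxP; exact: spectral_unitarymx.
have UU' : U^t* *m U = 1%:M by exact: mulmx1C.
have iU : invmx U = U^t* by apply: invmx_unitary; exact: spectral_unitarymx.
have SE : S = U^t* *m diag_mx d *m U.
  by rewrite -iU; exact/orthomx_spectralP.
pose u i := col i (U^t*).
have uA (A : op R N) i j : dot (u i) (A *m u j) = (U *m A *m U^t*) i j.
  rewrite dotE -mulmxA mxE; apply: eq_bigr => k _; congr (_ * _).
    by rewrite mxE adjE conjCK.
  by rewrite !mxE; apply: eq_bigr => l _; rewrite [in LHS]mxE.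
have u1 i : sqn (u i) = 1.
  apply: complexI; rewrite -dotuu -[u i in X in dot _ X]mul1mx uA mulmx1 UU.
  by rewrite mxE eqxx.
(* Each eigenvalue of X^t* X is the squared norm of X applied to its eigenvector, hence a
   nonnegative real. *)
have dE i : d 0 i = (sqn (X *m u i))%:C.
  rewrite -dotuu dotMl mulmxA uA {1}[_ *m X]SE !mulmxA UU mul1mx.
  by rewrite -mulmxA UU mulmx1 mxE eqxx.
exists u; split => //.
- move=> A; under eq_bigr do rewrite uA.
  by rewrite -/(mxtrace _) mxtrace_mulC mulmxA UU' mul1mx.
- move=> i; rewrite -dE mulmxA -/S /u.
  have SU : S *m U^t* = U^t* *m diag_mx d by rewrite {1}SE -[LHS]mulmxA UU mulmx1.
  apply/colP => k; transitivity ((S *m U^t*) k i).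
    by rewrite mxE [RHS]mxE; apply: eq_bigr => l _; congr (_ * _); rewrite mxE.
  by rewrite SU mul_mx_diag !mxE mulrC.
- rewrite /trace_norm /sqrtmx -/S -/U -/d iU mxtrace_mulC mulmxA UU mul1mx mxtrace_diag.
  rewrite raddf_sum; apply: eq_bigr => i _.
  by rewrite mxE dE sqrtC_real ?sqn_ge0 // vnormE.
Qed.

(** In the basis of right singular vectors, |tr (A X)| is at most the sum of |<u_i, A X u_i>|, hence
    at most b times the sum of the |X u_i|. *)
Lemma trbnd_trace_norm N (X : op R N) : trbnd X (trace_norm X).
Proof.
have [u [u1 trE _ ->]] := trace_norm_singular X.
move=> A b b0 hA; rewrite trE mulr_sumr.
apply: le_trans (normc_sum _) _; apply: ler_sum => i _.
by rewrite -mulmxA vnormE; exact: opbnd_sqrt.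
Qed.

Lemma trace_norm_le N (X : op R N) (b : R) : (forall i j, normc (X i j) <= b) ->
  trace_norm X <= N%:R * Num.sqrt (\sum_(i < N) (\sum_(j < N) b) ^+ 2).
Proof.
move=> Xb; have [u [u1 _ _ ->]] := trace_norm_singular X.
rewrite -[X in X%:R]card_ord -sumr_const mulr_suml; apply: ler_sum => i _.
rewrite mul1r; apply: le_trans (vnorm_mulmx_le _ _) _.
  by rewrite vnormE u1 sqrtr1.
rewrite ler_sqrt; last by apply: sumr_ge0 => k _; exact: sqr_ge0.
apply: ler_sum => k _; rewrite lerXn2r ?nnegrE //.
- by apply: sumr_ge0 => l _; exact: normc_ge0.
- by apply: sumr_ge0 => l _; apply: le_trans (Xb k l); exact: normc_ge0.
- by apply: ler_sum.
Qed.

Lemma psd_dot N (X : op R N) v : psd X -> 0 <= dot v (X *m v).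
Proof. by move=> /(_ v); rewrite -mulmxA dotdef. Qed.

Lemma dot_delta N (Y : op R N) i j :
  dot (delta_mx i 0) (Y *m delta_mx j 0) = Y i j.
Proof.
rewrite dotE -colE (bigD1 i) //= big1 ?addr0 => [|k ki].
  by rewrite !mxE !eqxx rmorph1 mul1r.
by rewrite mxE (negbTE ki) rmorph0 mul0r.
Qed.

(** Polarisation: [u + v] shows that the two cross terms have sum zero, [u + 'i v] that they have
    difference zero. *)
Lemma quadratic_form_eq0 N (Y : op R N) :
  (forall v, dot v (Y *m v) = 0) -> Y = 0.
Proof.
move=> h; apply/matrixP => i j; rewrite mxE -dot_delta.
move: (delta_mx i 0) (delta_mx j 0) => u v.
have h1 : dot u (Y *m v) + dot v (Y *m u) = 0.
  by have := h (u + v); rewrite mulmxDr !(dotDl, dotDr) !h add0r addr0.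
have h2 : dot u (Y *m v) - dot v (Y *m u) = 0.
  have := h (u + 'i%C *: v); rewrite mulmxDr -scalemxAr !(dotDl, dotDr) !dotZl !dotZr !h.
  rewrite !mulr0 add0r addr0 (_ : Num.conj 'i%C = - 'i%C :> R[i]); last first.
    by rewrite complexiE conjCi.
  rewrite mulNr -mulrBr => /eqP; rewrite mulf_eq0 => /orP[|/eqP //].
  by rewrite complexiE (negbTE (neq0Ci _)).
have : 2 * dot u (Y *m v) = 0.
  transitivity ((dot u (Y *m v) + dot v (Y *m u)) + (dot u (Y *m v) - dot v (Y *m u))).
    by ring.
  by rewrite h1 h2 addr0.
by move/eqP; rewrite mulf_eq0 pnatr_eq0 /= => /eqP.
Qed.

(** The quadratic form of X is real, so that of X - X^t* vanishes. *)
Lemma psd_adj N (X : op R N) : psd X -> X^t* = X.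
Proof.
move=> hX; apply/eqP; rewrite eq_sym -subr_eq0; apply/eqP.
apply: quadratic_form_eq0 => v; rewrite mulmxBl dotDr dotNr -dotMl.
rewrite -(dot_conj v); apply/eqP; rewrite subr_eq0; apply/eqP/esym.
by apply: conj_Creal; apply: ger0_real; exact: psd_dot.
Qed.

(** Each right singular vector of a positive X is an eigenvector for its singular value, so the |X
    u_i| sum to the trace. *)
Lemma trace_norm_psd N (X : op R N) : psd X -> (trace_norm X)%:C = \tr X.
Proof.
move=> hX; have [u [u1 trE XXu ->]] := trace_norm_singular X.
rewrite trE rmorph_sum; apply: eq_bigr => i _ /=; rewrite vnormE.
have [e|s0] := eqVneq (sqn (X *m u i)) 0.
  by rewrite (sqn_eq0 e) sqn0 sqrtr0 dot0r.
have sp : 0 < sqn (X *m u i) by rewrite lt_neqAle eq_sym s0 sqn_ge0.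
set s := Num.sqrt _; have s2 : sqn (X *m u i) = s ^+ 2 by rewrite sqr_sqrtr ?sqn_ge0.
have sgt : 0 < s by rewrite sqrtr_gt0.
(* w is in the eigenspace of X for -s, so positivity forces w = 0. *)
pose w := X *m u i - s%:C *: u i.
have Xw : X *m w = - s%:C *: w.
  have := XXu i; rewrite (psd_adj hX) s2 => XX.
  by rewrite /w mulmxBr XX -scalemxAr scaleNr scalerBr opprB scalerA rmorphXn expr2.
have w0 : sqn w = 0.
  have := psd_dot w hX; rewrite Xw dotZr dotuu -rmorphN -rmorphM /= ler0c.
  by have := sqn_ge0 w => a b; apply/eqP; rewrite eq_le a andbT; nra.
have -> : X *m u i = s%:C *: u i by apply/eqP; rewrite -subr_eq0 -/w (sqn_eq0 w0).
by rewrite dotZr dotuu u1 mulr1.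
Qed.

Lemma trbnd_state N (X : op R N) : quantum_state X -> trbnd X 1.
Proof.
case=> hX tr1; suff <- : trace_norm X = 1 by exact: trbnd_trace_norm.
by apply: complexI; rewrite trace_norm_psd.
Qed.

Lemma trbnd_psd_entry N (X : op R N) i j : psd X -> (normc (X i j))%:C <= \tr X.
Proof.
by move=> hX; rewrite -trace_norm_psd // lecR; apply/trbnd_entry/trbnd_trace_norm.
Qed.

End TraceNorm.

(** * Linear maps on operators and their matrix coefficients *)

Section LinearMaps.
Context {R : realType}.

(** [superop] is a bare function type; bundling the hypothesis makes the library lemmas on linear
    maps applicable. *)
Definition linear_of N (Phi : superop R N) (h : linear Phi) : {linear op R N -> op R N} :=
  HB.pack (Phi : op R N -> op R N) (GRing.isLinear.Build R[i] _ _ _ _ h).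

Lemma superopB N (Phi : superop R N) X Y : linear Phi -> Phi (X - Y) = Phi X - Phi Y.
Proof. by move=> h; exact: (raddfB (linear_of h)). Qed.

Lemma superopZ N (Phi : superop R N) a X : linear Phi -> Phi (a *: X) = a *: Phi X.
Proof. by move=> h; exact: (linearZ_LR (linear_of h)). Qed.

Lemma superop_sum N (Phi : superop R N) (I : Type) (s : seq I) (f : I -> op R N) :
  linear Phi -> Phi (\sum_(i <- s) f i) = \sum_(i <- s) Phi (f i).
Proof. by move=> h; exact: (raddf_sum (linear_of h)). Qed.

Lemma superop_entry N (Phi : superop R N) (X : op R N) i j : linear Phi ->
  Phi X i j = \sum_k \sum_l X k l * Phi (delta_mx k l) i j.
Proof.
move=> h; rewrite {1}(matrix_sum_delta X) superop_sum // summxE.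
apply: eq_bigr => k _; rewrite superop_sum // summxE; apply: eq_bigr => l _.
by rewrite superopZ // mxE.
Qed.

Lemma superop_entry_le N (Phi : superop R N) (B c : R) (X : op R N) i j : linear Phi ->
  (forall k l, normc (Phi (delta_mx k l) i j) <= B) ->
  (forall k l, normc (X k l) <= c) -> normc (Phi X i j) <= \sum_(k < N) \sum_(l < N) c * B.
Proof.
move=> h hB hc; rewrite superop_entry //; apply: le_trans (normc_sum _) _.
apply: ler_sum => k _; apply: le_trans (normc_sum _) _; apply: ler_sum => l _.
by rewrite Normc.normcM ler_pM ?normc_ge0.
Qed.

End LinearMaps.

(** * Ancillas: diamond norm, complete positivity and channels *)

Section Tensor.
Context {R : realType}.

Lemma big_mxtens m n (V : nmodType) (F : 'I_(m * n) -> V) :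
  \sum_k F k = \sum_i \sum_j F (mxtens_index (i, j)).
Proof.
rewrite pair_bigA /= (reindex (@mxtens_index m n)) /=.
  by apply: eq_bigr => -[i j] _.
exists (@mxtens_unindex m n) => k _; [exact: mxtens_indexK|exact: mxtens_unindexK].
Qed.

Lemma mxtrace_tens m n (A : op R m) (B : op R n) : \tr (A *t B) = \tr A * \tr B.
Proof.
by rewrite /mxtrace mulr_sum; apply: eq_bigr => i _; rewrite mxE.
Qed.

Lemma tens_idE N m (Phi : superop R N) (X : op R (N * m)) i j k l :
  tens_id Phi X (mxtens_index (i, k)) (mxtens_index (j, l)) =
  Phi (tens_block X k l) i j.
Proof.
rewrite summxE (bigD1 k) //= summxE (bigD1 l) //= tensmxE mxE !eqxx mulr1.
rewrite big1 ?addr0 => [|l' ll']; last first.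
  by rewrite tensmxE mxE (eq_sym l) (negbTE ll') andbF mulr0.
rewrite big1 ?addr0 // => k' kk'; rewrite summxE big1 // => l' _.
by rewrite tensmxE mxE (eq_sym k) (negbTE kk') mulr0.
Qed.

Lemma mxtensP m n p q (A B : 'M[R[i]]_(m * n, p * q)) :
  (forall i j k l, A (mxtens_index (i, k)) (mxtens_index (j, l)) =
                   B (mxtens_index (i, k)) (mxtens_index (j, l))) -> A = B.
Proof.
move=> h; apply/matrixP => a b.
by case: (mxtens_indexP a) => i k; case: (mxtens_indexP b) => j l.
Qed.

(** The component of [u] along the [k]-th basis vector of the ancilla. *)
Definition slice N m (k : 'I_m) (u : 'cV[R[i]]_(N * m)) : 'cV[R[i]]_N :=
  \col_i u (mxtens_index (i, k)) 0.

Lemma sqn_slice N m (k : 'I_m) (u : 'cV[R[i]]_(N * m)) : sqn (slice k u) <= sqn u.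
Proof.
rewrite sqn.unlock big_mxtens; apply: ler_sum => i _; rewrite mxE (bigD1 k) //= lerDl.
by apply: sumr_ge0 => j _; exact: sqr_ge0.
Qed.

Lemma dot_slice N m (k : 'I_m) (A : op R N) (u v : 'cV[R[i]]_(N * m)) :
  dot u ((A *t delta_mx k k) *m v) = dot (slice k u) (A *m slice k v).
Proof.
rewrite !dotE big_mxtens; apply: eq_bigr => i _.
rewrite (bigD1 k) //= big1 ?addr0 => [|l lk]; last first.
  rewrite mxE (big_mxtens (V := R[i])) big1 ?mulr0 // => j _; rewrite big1 // => l' _.
  by rewrite tensmxE mxE (negbTE lk) mulr0 mul0r.
rewrite [in RHS]mxE; congr (_ * _); rewrite mxE [RHS]mxE (big_mxtens (V := R[i])); apply: eq_bigr => j _.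
rewrite (bigD1 k) //= big1 ?addr0 => [|l lk]; last first.
  by rewrite tensmxE mxE (negbTE lk) andbF mulr0 mul0r.
by rewrite tensmxE !mxE !eqxx mulr1.
Qed.

Lemma tens_id_delta N m (Phi : superop R N) (X : op R N) (k : 'I_m) : linear Phi ->
  tens_id Phi (X *t delta_mx k k) = Phi X *t delta_mx k k.
Proof.
move=> h; apply: mxtensP => i j a b; rewrite tens_idE tensmxE.
have -> : tens_block (X *t delta_mx k k) a b = (delta_mx k k : op R m) a b *: X.
  by apply/matrixP => i' j'; rewrite !mxE !mxtens_indexK mulrC.
by rewrite superopZ // mxE mulrC.
Qed.

(** A pure ancilla state can be added or removed without affecting positivity, so complete
    positivity yields positivity of the map itself. *)
Lemma psd_tens_delta N m (X : op R N) (k : 'I_m) : psd X <-> psd (X *t delta_mx k k).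
Proof.
split=> hX v.
  by rewrite -mulmxA -[X in 0 <= X]dotdef dot_slice; exact: psd_dot.
rewrite -mulmxA -[X in 0 <= X]dotdef.
(* [w] is [v] tensored with the [k]-th basis vector. *)
pose w : 'cV[R[i]]_(N * m) :=
  \col_a (((mxtens_unindex a).2 == k)%:R * v (mxtens_unindex a).1 0).
have wE : slice k w = v by apply/colP => i; rewrite !mxE mxtens_indexK /= eqxx mul1r.
by have := psd_dot w hX; rewrite dot_slice wE.
Qed.

Lemma state_dim_gt0 N (X : op R N) : quantum_state X -> (0 < N)%N.
Proof.
case: N X => [|//] X [_ /eqP].
by rewrite /mxtrace big_ord0 eq_sym oner_eq0.
Qed.

(** An element of a set can be compared with its [sup] only once the set is known to be bounded;
    coarse bounds through matrix units suffice. *)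
Lemma has_ubound_diamond N (Phi : superop R N) : linear Phi ->
  has_ubound [set trace_norm (tens_id Phi X) |
              X in [set X : op R (N * N) | trace_norm X = 1]].
Proof.
move=> h.
pose B := \sum_k \sum_l \sum_i \sum_j normc (Phi (delta_mx k l) i j).
have hB k l i j : normc (Phi (delta_mx k l) i j) <= B.
  rewrite /B (bigD1 k) //= (bigD1 l) //= (bigD1 i) //= (bigD1 j) //=.
  by rewrite -!addrA lerDl !addr_ge0 //; repeat (apply: sumr_ge0 => ? _);
    exact: normc_ge0.
eexists => _ [X /= X1 <-].
apply: (@trace_norm_le _ _ _ (\sum_(k < N) \sum_(l < N) 1 * B)) => a b.
case: (mxtens_indexP a) => i k; case: (mxtens_indexP b) => j l; rewrite tens_idE.
apply: superop_entry_le => // k' l'; rewrite mxE -X1.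
exact/trbnd_entry/trbnd_trace_norm.
Qed.

(** X tensored with a rank-one projection E has trace norm one and is admissible in the supremum;
    testing its image against A tensored with E gives back tr (A Phi(X)). *)
Lemma trbnd_diamond N (Phi : superop R N) (X : op R N) : linear Phi ->
  quantum_state X -> trbnd (Phi X) (diamond_norm Phi).
Proof.
move=> h hX; have N0 := state_dim_gt0 hX; pose k := Ordinal N0; case: hX => hX tr1.
pose E : op R N := delta_mx k k.
have trE : \tr E = 1.
  rewrite /mxtrace (bigD1 k) //= big1 ?addr0 ?mxE ?eqxx // => l lk.
  by rewrite mxE (negbTE lk).
have X1 : trace_norm (X *t E) = 1.
  apply: complexI; rewrite trace_norm_psd; last by apply/(psd_tens_delta X k).
  by rewrite mxtrace_tens tr1 trE mul1r.
apply: (@trbnd_le _ _ _ (trace_norm (tens_id Phi (X *t E)))).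
  by apply: ub_le_sup; [exact: has_ubound_diamond|exists (X *t E)].
move=> A b b0 hA; rewrite tens_id_delta //.
have := @trbnd_trace_norm _ _ (Phi X *t E) (A *t E) b b0.
rewrite tensmx_mul mxtrace_tens mul_delta_mx trE mulr1; apply=> u v.
rewrite dot_slice; apply: le_trans (hA _ _) _; apply: ler_wpM2l => //.
by rewrite ler_pM2r ?invr_gt0 // lerD ?sqn_slice.
Qed.

Lemma channel_state N (Phi : superop R N) (X : op R N) :
  quantum_channel Phi -> quantum_state X -> quantum_state (Phi X).
Proof.
move=> [h cp tp] hX; have N0 := state_dim_gt0 hX; pose k := Ordinal N0; case: hX => hX tr1.
split; last by rewrite tp.
apply/(psd_tens_delta (Phi X) k); rewrite -tens_id_delta //; apply: cp.
by apply/(psd_tens_delta X k).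
Qed.

(* Evaluate Phi (x) id on the unnormalised maximally entangled state w w^t*. *)
Lemma channel_entry N (Phi : superop R N) k l i j :
  quantum_channel Phi -> normc (Phi (delta_mx k l) i j) <= N%:R.
Proof.
move=> [h cp tp].
pose w : 'cV[R[i]]_(N * N) :=
  \col_a ((mxtens_unindex a).1 == (mxtens_unindex a).2)%:R.
have W : psd (w *m w^t*).
  move=> v; rewrite !mulmxA -mulmxA mxE big_ord1 -(dotdef v w) -(dotdef w v) -(dot_conj w v).
  by rewrite -normc_sqr ler0c sqr_ge0.
have blk a b : tens_block (w *m w^t*) a b = delta_mx a b.
  apply/matrixP => i' j'; rewrite mxE mxE big_ord1 adjE !mxE !mxtens_indexK /=.
  by rewrite conjC_nat -natrM mulnb.
rewrite -lecR -(blk k l) -tens_idE.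
apply: le_trans (trbnd_psd_entry _ _ (cp _ _ W)) _.
(* The diagonal blocks are the images of diagonal matrix units, so trace preservation gives total
   trace N. *)
rewrite /mxtrace big_mxtens exchange_big /=.
under eq_bigr => a _ do under eq_bigr => b _ do rewrite tens_idE blk.
under eq_bigr => a _ do rewrite -/(mxtrace _) tp.
under eq_bigr => a _.
  rewrite /mxtrace (bigD1 a) //= big1 ?addr0 => [|b ba]; last by rewrite mxE (negbTE ba).
  rewrite mxE !eqxx; over.
by rewrite sumr_const card_ord rmorph_nat.
Qed.

End Tensor.

(** * Algebraic identities for the generator and its dual *)

Section Rearrange.

(* Over an abstract ring, because [ring] is far too slow on these over [R[i]]. *)
Lemma lindblad_rearrange (K : comPzRingType) m n (x y : K) (a b c d e : 'M[K]_(m, n)) :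
  - (x *: (a - b)) + c - y *: (d + e) =
  c - (x *: a + y *: d) - (- x *: b + y *: e).
Proof. by apply/matrixP => i j; rewrite !mxE; ring. Qed.

Lemma lindblad_rearrange_linear (K : comPzRingType) m n (k x y : K)
    (a b c d e a' b' c' d' e' : 'M[K]_(m, n)) :
  - (x *: (k *: a + a' - (k *: b + b'))) + (k *: c + c') -
    y *: (k *: d + d' + (k *: e + e')) =
  k *: (- (x *: (a - b)) + c - y *: (d + e)) +
    (- (x *: (a' - b')) + c' - y *: (d' + e')).
Proof. by apply/matrixP => i j; rewrite !mxE; ring. Qed.

Lemma mxtraceN (K : pzRingType) n (A : 'M[K]_n) : \tr (- A) = - \tr A.
Proof. exact: raddfN. Qed.

(** The dual of an Euler step: when V' and G' are the adjoints and s >= 0, a completely positive map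
    minus a correction of second order in [s]. *)
Lemma lindblad_rearrange_trace (K : comPzRingType) n (s : K)
    (A X V V' G G' : 'M[K]_n) :
  \tr (A *m (X + s *: (V *m X *m V' - G *m X - X *m G'))) =
  \tr (((1%:M - s *: G') *m A *m (1%:M - s *: G) + s *: (V' *m A *m V)
        - s ^+ 2 *: (G' *m A *m G)) *m X).
Proof.
do 4!rewrite ?(mulmxDl, mulmxDr, mulNmx, mulmxN, mul1mx, mulmx1)
  -?(scalemxAl, scalemxAr).
do 4!rewrite ?(mxtraceD, mxtraceN, mxtraceZ).
rewrite !mulmxA [\tr (A *m X *m G')]mxtrace_mulC.
rewrite [\tr (A *m V *m X *m V')]mxtrace_mulC !mulmxA.
ring.
Qed.

End Rearrange.

Section RealComplex.
Context {R : realType}.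

Lemma realcD (x y : R) : (x + y)%:C = x%:C + y%:C.
Proof. exact: rmorphD. Qed.

Lemma realc_affine (x y a : R) : (x + a * y)%:C = x%:C + a%:C * y%:C.
Proof. by rewrite realcD rmorphM. Qed.

Lemma realcX (x : R) n : (x ^+ n)%:C = x%:C ^+ n.
Proof. exact: rmorphXn. Qed.

Lemma normc_lincomb (x y z : R[i]) (a b : R) : 0 <= a -> 0 <= b ->
  normc (x + a%:C * y - b%:C * z) <= normc x + a * normc y + b * normc z.
Proof.
move=> a0 b0; apply: le_trans (le_normcB _ _) _.
rewrite Normc.normcM normcR ger0_norm // lerD2r.
by apply: le_trans (le_normcD _ _) _; rewrite Normc.normcM normcR ger0_norm.
Qed.

Lemma dot_sandwich N (K A : op R N) u v :
  dot u (K^t* *m A *m K *m v) = dot (K *m u) (A *m (K *m v)).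
Proof. by rewrite dotMl !mulmxA. Qed.

Lemma dot_lincomb N (X Y Z : op R N) a b u v :
  dot u ((X + a *: Y - b *: Z) *m v) =
  dot u (X *m v) + a * dot u (Y *m v) - b * dot u (Z *m v).
Proof.
by rewrite mulmxBl mulmxDl -!scalemxAl dotDr dotNr dotDr !dotZr.
Qed.

Lemma dot_sub_scale N (x y : 'cV[R[i]]_N) (s : R) :
  dot (x - s%:C *: y) (x - s%:C *: y) =
  dot x x - s%:C * (dot y x + dot x y) + s%:C ^+ 2 * dot y y.
Proof.
rewrite dotDl !dotDr dotNl !dotNr !dotZl !dotZr dotNl dotZl.
rewrite (_ : Num.conj s%:C = s%:C); last exact: conjc_real.
by ring.
Qed.

End RealComplex.

(** * Almost-contractivity of Euler steps of a Lindblad generator *)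

Section Lindblad.
Context {R : realType}.

(* A substitute, stable under averaging, for generating a contraction semigroup. *)
Definition quasi_dissipative N (lambda : R) (S : superop R N) : Prop :=
  forall (s : R) X c, 0 <= s -> trbnd X c ->
  trbnd (X + s%:C *: S X) ((1 + 5 * s ^+ 2 * lambda ^+ 2) * c).

(** [G] is 'i times the effective non-Hermitian Hamiltonian H - ('i / 2) V^t* V. *)
Lemma lindbladianE N (H V X : op R N) : H^t* = H ->
  let G := 'i%R *: H + 2^-1 *: (V^t* *m V) in
  lindbladian H V X = V *m X *m V^t* - G *m X - X *m G^t*.
Proof.
move=> hH G; rewrite /lindbladian /G adjD !adjZ hH adjM trmxCK.
rewrite conjCi.
rewrite (_ : Num.conj 2^-1 = 2^-1 :> R[i]); last by rewrite fmorphV /= conjC_nat.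
rewrite mulmxDl mulmxDr -!scalemxAl -!scalemxAr.
move: (H *m X) (X *m H) (V *m X *m V^t*) (V^t* *m V *m X) (X *m (V^t* *m V)).
exact: lindblad_rearrange.
Qed.

Lemma lindbladian_linear N (H V : op R N) : linear (lindbladian H V).
Proof.
move=> a X Y; rewrite /lindbladian !(mulmxDr, mulmxDl) -!scalemxAr -!scalemxAl.
move: (H *m X) (X *m H) (V *m X *m V^t*) (V^t* *m V *m X) (X *m (V^t* *m V)).
move: (H *m Y) (Y *m H) (V *m Y *m V^t*) (V^t* *m V *m Y) (Y *m (V^t* *m V)).
move=> *; exact: lindblad_rearrange_linear.
Qed.

Lemma lindbladian_quasi_dissipative N (H V : op R N) lambda :
  0 <= lambda -> H \is hermsymmx ->
  (forall u, sqn (H *m u) <= lambda ^+ 2 * sqn u) ->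
  (forall u, sqn (V *m u) <= lambda * sqn u) ->
  quasi_dissipative lambda (lindbladian H V).
Proof.
move=> l0 hermH hH hV s X c s0 hX.
have adjH : H^t* = H.
  by have /is_hermitianmxP := hermH; rewrite expr0 scale1r => {2}->.
pose G := 'i%R *: H + 2^-1 *: (V^t* *m V); pose K : op R N := 1%:M - s%:C *: G.
have GE u : G *m u = 'i%R *: (H *m u) + 2^-1 *: (V^t* *m (V *m u)).
  by rewrite /G mulmxDl -!scalemxAl mulmxA.
(* 5/2 = 2 + 2 / 4: the factor 2 of [sqnD], once for H and once for half of V^t* V. *)
have hG u : sqn (G *m u) <= 5 / 2 * lambda ^+ 2 * sqn u.
  rewrite GE; apply: le_trans (sqnD _ _) _; rewrite !sqnZ.
  have -> : normc ('i%R : R[i]) = 1 by apply: complexI; rewrite -normc_normr normCi.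
  have -> : normc (2^-1 : R[i]) = 2^-1.
    by rewrite Normc.normcV -(rmorph_nat (real_complex R)) normcR ger0_norm.
  have := sqn_adj l0 hV (V *m u).
  have := ler_wpM2l l0 (hV u); have := hH u; nra.
(* G + G^t* = V^t* V, the infinitesimal form of trace preservation; it makes the first-order terms
   cancel in [KV]. *)
have ReG u : dot (G *m u) u + dot u (G *m u) = (sqn (V *m u))%:C.
  have HH : dot (H *m u) u = dot u (H *m u) by rewrite dotMl adjH.
  rewrite GE dotDl dotDr !dotZl !dotZr HH.
  rewrite conjCi.
  rewrite (_ : Num.conj 2^-1 = 2^-1 :> R[i]); last by rewrite fmorphV /= conjC_nat.
  rewrite dotMl trmxCK -[dot u (V^t* *m _)]dotMl dotuu.
  by field.
have KV u : sqn (K *m u) + s * sqn (V *m u) = sqn u + s ^+ 2 * sqn (G *m u).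
  apply: complexI; apply: (etrans (realc_affine _ _ _)).
  apply: (etrans _ (esym (realc_affine _ _ _))); 
  rewrite (realcX s 2) -(ReG u) -(dotuu u) -(dotuu (K *m u)) -(dotuu (G *m u)).
  rewrite /K mulmxBl mul1mx -scalemxAl dot_sub_scale.
  by rewrite addrAC subrK.
have LE : lindbladian H V X = V *m X *m V^t* - G *m X - X *m G^t*.
  exact: lindbladianE.
move: @K KV; move: (G) hG LE => {ReG GE}{}G hG LE K KV A b b0 hA.
pose B := K^t* *m A *m K + s%:C *: (V^t* *m A *m V) - (s ^+ 2)%:C *: (G^t* *m A *m G).
have -> : \tr (A *m (X + s%:C *: lindbladian H V X)) = \tr (B *m X).
  rewrite LE lindblad_rearrange_trace /B /K adjD adjN adjZ adj1 realcX.
  by rewrite (_ : Num.conj s%:C = s%:C); last exact: conjc_real.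
have hB : opbnd B ((1 + 5 * s ^+ 2 * lambda ^+ 2) * b).
  move=> u v.
  have -> : dot u (B *m v) = dot (K *m u) (A *m (K *m v)) +
      s%:C * dot (V *m u) (A *m (V *m v)) - (s ^+ 2)%:C * dot (G *m u) (A *m (G *m v)).
    by rewrite dot_lincomb !dot_sandwich.
  apply: le_trans (normc_lincomb _ _ _ s0 (sqr_ge0 s)) _.
  have h2 := hA (K *m u) (K *m v).
  have h3 := ler_wpM2l s0 (hA (V *m u) (V *m v)).
  have h4 := ler_wpM2l (sqr_ge0 s) (hA (G *m u) (G *m v)).
  (* Two equal s^2 terms in G appear, one from [KV] and one from the correction in [B]; together
     they double 5/2 to 5. *)
  have h5 : b * ((sqn (K *m u) + sqn (K *m v)) / 2) +
      s * (b * ((sqn (V *m u) + sqn (V *m v)) / 2)) +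
      s ^+ 2 * (b * ((sqn (G *m u) + sqn (G *m v)) / 2)) =
      b / 2 * (sqn u + sqn v) + b * s ^+ 2 * (sqn (G *m u) + sqn (G *m v)).
    transitivity (b / 2 * ((sqn (K *m u) + s * sqn (V *m u)) +
        (sqn (K *m v) + s * sqn (V *m v))) +
      s ^+ 2 * (b * ((sqn (G *m u) + sqn (G *m v)) / 2))); first by field.
    by rewrite !KV; field.
  have h6 : b * s ^+ 2 * (sqn (G *m u) + sqn (G *m v)) <=
      b * s ^+ 2 * (5 / 2 * lambda ^+ 2 * (sqn u + sqn v)).
    by rewrite ler_wpM2l ?mulr_ge0 ?sqr_ge0 // mulrDr lerD.
  have -> : (1 + 5 * s ^+ 2 * lambda ^+ 2) * b * ((sqn u + sqn v) / 2) =
     b / 2 * (sqn u + sqn v) + b * s ^+ 2 * (5 / 2 * lambda ^+ 2 * (sqn u + sqn v)).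
    by field.
  apply: le_trans (lerD (lerD h2 h3) h4) _.
  by rewrite h5 lerD2l.
rewrite mulrA [b * _]mulrC; apply: hX hB.
by rewrite mulr_ge0 // addr_ge0 // !mulr_ge0 ?sqr_ge0.
Qed.

(** S X = lambda ((X + S X / lambda) - X), and the step s = 1 / lambda grows by at most 1 + 5, so 7
    = 6 + 1. *)
Lemma quasi_dissipative_bound N lambda (S : superop R N) X c : 0 < lambda ->
  quasi_dissipative lambda S -> trbnd X c -> trbnd (S X) (7 * lambda * c).
Proof.
move=> l0 hS hX.
have li : 0 <= lambda^-1 by rewrite invr_ge0 ltW.
have := trbndZr (ltW l0) (trbndD (hS _ _ _ li hX) (trbndN hX)).
rewrite addrAC subrr add0r scalerA -rmorphM /= divff ?gt_eqF // scale1r.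
apply: trbnd_le; rewrite le_eqVlt; apply/orP; left; apply/eqP.
by field; rewrite gt_eqF.
Qed.

End Lindblad.

(** * Scalar estimates for the exponential *)

Section Exponential.
Context {R : realType}.

Lemma exp_series_le (x : R) m : 0 <= x -> \sum_(k < m) x ^+ k / k`!%:R <= expR x.
Proof.
move=> x0; rewrite /expR; set u := series (exp_coeff x).
have <- : u m = \sum_(k < m) x ^+ k / k`!%:R.
  by rewrite /u /series /= big_mkord.
apply: nondecreasing_cvgn_le; last exact: is_cvg_series_exp_coeff.
by apply: nondecreasing_series => n _ _; exact: exp_coeff_ge0.
Qed.

(** Multiply (1 - x) exp x <= 1 by 1 + x. *)
Lemma expR_quadratic (x : R) : 0 <= x -> expR x - (1 + x) <= x ^+ 2 * expR x.
Proof.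
move=> x0; have h := expR_ge1Dx (- x); have e0 := expR_gt0 x.
have h2 : expR (- x) * expR x = 1 by rewrite expRN mulVf // gt_eqF.
have h3 : (1 - x) * expR x <= 1 by rewrite -[leRHS]h2 ler_pM2r.
nra.
Qed.

Lemma bernoulli (w : R) p : 0 <= w <= 1 -> 1 - p%:R * w <= (1 - w) ^+ p.
Proof.
move=> /andP[w0 w1]; elim: p => [|p IH]; first by rewrite mul0r subr0 expr0.
rewrite exprS; have h : 0 <= 1 - w by rewrite subr_ge0.
apply: le_trans (ler_wpM2l h IH).
have : 0 <= p%:R * (w * w) by rewrite !mulr_ge0.
rewrite -natr1; nra.
Qed.

(** With z = y / p, the p-th power of (1 - z^2) exp z <= 1 + z, followed by Bernoulli's
    inequality. *)
Lemma expR_euler (y : R) p : 0 <= y -> (0 < p)%N ->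
  expR y - (1 + y / p%:R) ^+ p <= expR y * y ^+ 2 / p%:R.
Proof.
move=> y0 p0; have pp : 0 < p%:R :> R by rewrite ltr0n.
set z := y / p%:R; have z0 : 0 <= z by rewrite divr_ge0 // ltW.
have yE : y = z * p%:R by rewrite /z divfK ?gt_eqF.
have -> : expR y * y ^+ 2 / p%:R = expR y * (p%:R * z ^+ 2).
  by rewrite {2}yE; field; rewrite gt_eqF.
suff : expR y * (1 - p%:R * z ^+ 2) <= (1 + z) ^+ p by lra.
(* For z^2 > 1 Bernoulli does not apply, but the left-hand side is then nonpositive. *)
have [z1|z1] := leP (z ^+ 2) 1; last first.
  apply: (@le_trans _ _ 0); last by rewrite exprn_ge0 // addr_ge0.
  rewrite mulr_ge0_le0 ?expR_ge0 // subr_le0.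
  have : 1 <= p%:R :> R by rewrite ler1n.
  nra.
have b := @bernoulli (z ^+ 2) p; rewrite sqr_ge0 z1 in b.
apply: (@le_trans _ _ (expR y * (1 - z ^+ 2) ^+ p)).
  by rewrite ler_pM2l ?expR_gt0 // b.
have -> : expR y = expR z ^+ p by rewrite -expRM_natr -yE.
rewrite -exprMn lerXn2r ?nnegrE ?mulr_ge0 ?expR_ge0 ?subr_ge0 ?addr_ge0 //.
have h := expR_ge1Dx (- z).
have h2 : expR (- z) * expR z = 1 by rewrite expRN mulVf // gt_eqF ?expR_gt0.
have h3 : (1 - z) * expR z <= 1 by rewrite -[leRHS]h2 ler_pM2r ?expR_gt0.
have := ler_wpM2l (addr_ge0 ler01 z0) h3; nra.
Qed.

End Exponential.

(** Equivalently 'C(p, k) / p^k <= 1 / k!, which compares Euler's coefficients with those of the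
    exponential. *)
Lemma ffact_le_expn n m : (n ^_ m <= n ^ m)%N.
Proof.
elim: m => // m IH; rewrite ffactnSr expnSr.
by apply: leq_mul => //; exact: leq_subr.
Qed.

(** * Exponentials of maps, Taylor and Euler approximations *)

Section SuperExponential.
Context {R : realType}.

Definition trbounded N (K : R) (S : superop R N) : Prop :=
  forall X c, trbnd X c -> trbnd (S X) (K * c).

Lemma trbnd_iter N K (S : superop R N) k X c : trbounded K S -> trbnd X c ->
  trbnd (iter k S X) (K ^+ k * c).
Proof.
move=> hS hX; elim: k => [|k IH]; first by rewrite expr0 mul1r.
by rewrite iterS exprS -mulrA; exact: hS.
Qed.

Lemma trbnd_powersum N K (S : superop R N) (al : nat -> R) m X c :
  (forall k, 0 <= al k) -> trbounded K S -> trbnd X c ->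
  trbnd (\sum_(k < m) (al k)%:C *: iter k S X) ((\sum_(k < m) al k * K ^+ k) * c).
Proof.
move=> al0 hS hX; rewrite mulr_suml; apply: trbnd_sum => k.
by rewrite -mulrA; apply: trbndZr => //; exact: trbnd_iter.
Qed.

Lemma exp_coeff_ge0' (t : R) k : 0 <= t -> 0 <= t ^+ k / k`!%:R.
Proof. by move=> t0; rewrite divr_ge0 ?exprn_ge0. Qed.

(** [f] stands for the real or the imaginary part; the comparison series is c exp (t K). *)
Lemma exp_psum_part_cvg N K (S : superop R N) (f : R[i] -> R) t X c i j :
  f 0 = 0 -> (forall x y, f (x + y) = f x + f y) ->
  (forall z, `|f z| <= normc z) ->
  0 <= t -> 0 <= K -> trbounded K S -> trbnd X c ->
  cvgn (fun m => f (exp_psum t S X m i j)).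
Proof.
move=> f0 fD fn t0 K0 hS hX.
pose u k := f (((t ^+ k / k`!%:R)%:C *: iter k S X) i j).
have -> : (fun m => f (exp_psum t S X m i j)) = series u.
  apply/funext => m; rewrite /exp_psum summxE /series /= big_mkord.
  by elim: m => [|m IH]; rewrite ?big_ord0 // !big_ord_recr /= fD IH.
apply: normed_cvg.
have cv : cvgn (series (c *: exp_coeff (t * K))).
  by apply: is_cvg_seriesZ; exact: is_cvg_series_exp_coeff.
apply: series_le_cvg cv => k; first exact: normr_ge0.
  apply: mulr_ge0; first exact: trbnd_ge0 hX.
  by apply: exp_coeff_ge0; rewrite mulr_ge0.
apply: le_trans (fn _) _; rewrite mxE Normc.normcM normcR ger0_norm ?exp_coeff_ge0' //.
rewrite [leRHS](_ : _ = t ^+ k / k`!%:R * (K ^+ k * c)).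
  rewrite ler_wpM2l ?exp_coeff_ge0' //.
  by apply: trbnd_entry; exact: trbnd_iter.
rewrite [LHS](_ : _ = c * exp_coeff (t * K) k) // exp_coeffE exprMn.
by ring.
Qed.

Lemma exp_psum_Re_cvg N K (S : superop R N) t X c i j :
  0 <= t -> 0 <= K -> trbounded K S -> trbnd X c ->
  complex.Re (exp_psum t S X m i j) @[m --> \oo] --> complex.Re (exp_superop t S X i j).
Proof.
move=> t0 K0 hS hX; rewrite mxE /=; apply: exp_psum_part_cvg t0 K0 hS hX => //.
  by case=> a b [].
exact: ler_normcRe.
Qed.

Lemma exp_psum_Im_cvg N K (S : superop R N) t X c i j :
  0 <= t -> 0 <= K -> trbounded K S -> trbnd X c ->
  complex.Im (exp_psum t S X m i j) @[m --> \oo] --> complex.Im (exp_superop t S X i j).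
Proof.
move=> t0 K0 hS hX; rewrite mxE /=; apply: exp_psum_part_cvg t0 K0 hS hX => //.
  by case=> a b [].
exact: ler_normcIm.
Qed.

(** The test operator is fixed before the rank m is chosen, so entrywise convergence suffices. *)
Lemma trbnd_exp_limit N K (S : superop R N) t X c Z B m0 :
  0 <= t -> 0 <= K -> trbounded K S -> trbnd X c ->
  (forall m, (m0 <= m)%N -> trbnd (exp_psum t S X m - Z) B) ->
  trbnd (exp_superop t S X - Z) B.
Proof.
move=> t0 K0 hS hX hZ A b b0 hA; apply/ler_addgt0Pr => e e0.
set E := exp_superop t S X.
(* An entrywise error e / a costs at most e in the trace against A; the summand 1 keeps [a]
   positive. *)
pose a := 1 + \sum_i \sum_j normc (A i j).
have a0 : 0 < a.
  by rewrite ltr_pwDl // !sumr_ge0 // => i _; rewrite sumr_ge0 // => j _; exact: normc_ge0.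
have ReB (Y Y' : op R N) i j :
    complex.Re ((Y - Y') i j) = complex.Re (Y i j) - complex.Re (Y' i j).
  by rewrite 2!mxE; case: (Y i j) (Y' i j) => ? ? [].
have ImB (Y Y' : op R N) i j :
    complex.Im ((Y - Y') i j) = complex.Im (Y i j) - complex.Im (Y' i j).
  by rewrite 2!mxE; case: (Y i j) (Y' i j) => ? ? [].
have : \forall m \near \oo, forall i j, normc ((E - exp_psum t S X m) i j) <= e / a.
  apply: filter_forall => i; apply: filter_forall => j.
  have h0 : 0 < e / a / 2 by rewrite !divr_gt0.
  have /cvgrPdist_le/(_ _ h0) hRe := exp_psum_Re_cvg (i := i) (j := j) t0 K0 hS hX.
  have /cvgrPdist_le/(_ _ h0) hIm := exp_psum_Im_cvg (i := i) (j := j) t0 K0 hS hX.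
  near=> m; apply: le_trans (normc_ReIm _) _; rewrite [leRHS]splitr ReB ImB.
  by rewrite lerD //; near: m.
case=> m1 _ hm1; pose m := maxn m0 m1.
have hm := hm1 m (leq_maxr _ _).
have -> : E - Z = (E - exp_psum t S X m) + (exp_psum t S X m - Z) by rewrite addrA subrK.
rewrite mulmxDr mxtraceD addrC; apply: le_trans (le_normcD _ _) _.
apply: lerD; first exact: (hZ m (leq_maxl _ _)).
rewrite /mxtrace; apply: le_trans (normc_sum _) _.
apply: (@le_trans _ _ (\sum_i \sum_j normc (A i j) * (e / a))).
  apply: ler_sum => i _; rewrite mxE; apply: le_trans (normc_sum _) _.
  by apply: ler_sum => j _; rewrite Normc.normcM ler_wpM2l ?normc_ge0.
under eq_bigr do rewrite -mulr_suml; rewrite -mulr_suml mulrA ler_pdivrMr //.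
by rewrite mulrC; apply: ler_wpM2l; [exact: ltW|rewrite /a lerDr].
Unshelve. all: end_near. Qed.

(** Needed because diamond-norm bounds are applied to the difference of a channel and an
    exponential, which has to be linear. *)
Lemma exp_superop_linear N K (S : superop R N) t :
  (forall X : op R N, exists c, trbnd X c) ->
  0 <= t -> 0 <= K -> trbounded K S -> linear S -> linear (exp_superop t S).
Proof.
move=> hb t0 K0 hS lS a X Y.
have lI k : linear (iter k S).
  elim: k => // k IH u v Z; rewrite !iterS IH; exact: lS.
have lP m : exp_psum t S (a *: X + Y) m = a *: exp_psum t S X m + exp_psum t S Y m.
  rewrite /exp_psum scaler_sumr -big_split /=; apply: eq_bigr => k _.
  by rewrite lI scalerDr !scalerA mulrC.
have [c hX] := hb X; have [c' hY] := hb Y; have [c2 hXY] := hb (a *: X + Y).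
apply/matrixP => i j.
have hRX := exp_psum_Re_cvg (i := i) (j := j) t0 K0 hS hX; have hIX := exp_psum_Im_cvg (i := i) (j := j) t0 K0 hS hX.
have hRY := exp_psum_Re_cvg (i := i) (j := j) t0 K0 hS hY; have hIY := exp_psum_Im_cvg (i := i) (j := j) t0 K0 hS hY.
have hR := exp_psum_Re_cvg (i := i) (j := j) t0 K0 hS hXY; have hI := exp_psum_Im_cvg (i := i) (j := j) t0 K0 hS hXY.
have ReE (k z w : R[i]) : complex.Re (k * z + w) =
    complex.Re k * complex.Re z - complex.Im k * complex.Im z + complex.Re w.
  by case: k z w => ? ? [? ?] [].
have ImE (k z w : R[i]) : complex.Im (k * z + w) =
    complex.Re k * complex.Im z + complex.Im k * complex.Re z + complex.Im w.
  by case: k z w => ? ? [? ?] [].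
have entE (Y1 Y2 : op R N) : (a *: Y1 + Y2) i j = a * Y1 i j + Y2 i j.
  by rewrite mxE [X in X + _]mxE.
have eR : complex.Re (exp_superop t S (a *: X + Y) i j) =
    complex.Re (a * exp_superop t S X i j + exp_superop t S Y i j).
  rewrite ReE; apply: (cvg_unique _ hR) => //.
  rewrite (_ : (fun m => complex.Re (exp_psum t S (a *: X + Y) m i j)) = fun m =>
    complex.Re a * complex.Re (exp_psum t S X m i j)
    - complex.Im a * complex.Im (exp_psum t S X m i j)
    + complex.Re (exp_psum t S Y m i j)); last first.
    by apply/funext => m; rewrite lP entE ReE.
  apply: (cvgD _ hRY); apply: cvgB.
    exact: (cvgM (cvg_cst _) hRX).
  exact: (cvgM (cvg_cst _) hIX).
have eI : complex.Im (exp_superop t S (a *: X + Y) i j) =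
    complex.Im (a * exp_superop t S X i j + exp_superop t S Y i j).
  rewrite ImE; apply: (cvg_unique _ hI) => //.
  rewrite (_ : (fun m => complex.Im (exp_psum t S (a *: X + Y) m i j)) = fun m =>
    complex.Re a * complex.Im (exp_psum t S X m i j)
    + complex.Im a * complex.Re (exp_psum t S X m i j)
    + complex.Im (exp_psum t S Y m i j)); last first.
    by apply/funext => m; rewrite lP entE ImE.
  apply: (cvgD _ hIY); apply: cvgD.
    exact: (cvgM (cvg_cst _) hIX).
  exact: (cvgM (cvg_cst _) hRX).
rewrite entE; apply/eqP; rewrite eq_complex.
by rewrite eR eI !eqxx.
Qed.

(* Both the first-order Taylor polynomial and the Euler scheme (1 + (t/p) S)^p
   have coefficients dominated by those of exp (t S). *)
Lemma trbnd_exp_dominated N K (S : superop R N) t X c Z (be : nat -> R) m0 :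
  0 <= t -> 0 <= K -> trbounded K S -> trbnd X c ->
  (forall k, 0 <= be k <= t ^+ k / k`!%:R) ->
  (forall m, (m0 <= m)%N -> Z = \sum_(k < m) (be k)%:C *: iter k S X) ->
  trbnd (exp_superop t S X - Z) ((expR (t * K) - \sum_(k < m0) be k * K ^+ k) * c).
Proof.
move=> t0 K0 hS hX hbe hZ; apply: (trbnd_exp_limit (m0 := m0) t0 K0 hS hX) => m lem.
pose al k := t ^+ k / k`!%:R - be k.
have al0 k : 0 <= al k by rewrite subr_ge0; case/andP: (hbe k).
have -> : exp_psum t S X m - Z = \sum_(k < m) (al k)%:C *: iter k S X.
  rewrite (hZ m lem) /exp_psum -sumrB; apply: eq_bigr => k _.
  by rewrite -scalerBl /al rmorphB.
apply: trbnd_le (trbnd_powersum m al0 hS hX).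
rewrite ler_wpM2r ?(trbnd_ge0 hX) //.
have -> : \sum_(k < m) al k * K ^+ k =
    \sum_(k < m) (t * K) ^+ k / k`!%:R - \sum_(k < m) be k * K ^+ k.
  by rewrite -sumrB; apply: eq_bigr => k _; rewrite /al mulrBl exprMn mulrAC.
apply: lerB; first by apply: exp_series_le; rewrite mulr_ge0.
rewrite (big_ord_widen _ (fun k => be k * K ^+ k) lem) [leRHS](bigID (fun k : 'I_m => k < m0)%N) /=.
rewrite lerDl sumr_ge0 // => k _; rewrite mulr_ge0 ?exprn_ge0 //.
by case/andP: (hbe k).
Qed.

Lemma trbnd_exp_taylor N K (S : superop R N) t X c :
  0 <= t -> 0 <= K -> trbounded K S -> trbnd X c ->
  trbnd (exp_superop t S X - (X + t%:C *: S X)) ((t * K) ^+ 2 * expR (t * K) * c).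
Proof.
move=> t0 K0 hS hX.
pose be k : R := if (k < 2)%N then t ^+ k / k`!%:R else 0.
apply: trbnd_le (trbnd_exp_dominated (be := be) (m0 := 2) t0 K0 hS hX _ _).
- rewrite ler_wpM2r ?(trbnd_ge0 hX) // 2!big_ord_recl big_ord0 /be /=.
  rewrite /bump /= !expr0 !expr1 fact0 factS fact0 muln1 !divr1 mulr1 addr0.
  by apply: expR_quadratic; rewrite mulr_ge0.
- by move=> k; rewrite /be; case: ltnP => _; rewrite ?lexx exp_coeff_ge0'.
- case=> [|[|m]] // _; rewrite 2!big_ord_recl big1 => [|k _]; last first.
    by rewrite /be /= scale0r.
  by rewrite /be /= /bump /= expr0 expr1 fact0 factS fact0 muln1 !divr1 scale1r addr0.
Qed.

(** The binomial expansion, by Pascal's rule. Binomials vanish beyond p, so the range may be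
    extended to match any longer partial sum of the exponential. *)
Lemma iter_euler N (S : superop R N) (s : R) p X m : linear S -> (p < m)%N ->
  iter p (fun Y => Y + s%:C *: S Y) X =
  \sum_(k < m) ('C(p, k)%:R * s ^+ k)%:C *: iter k S X.
Proof.
move=> lS; elim: p m => [|p IH] [|m] // pm.
  rewrite big_ord_recl big1 ?addr0 => [|k _]; last by rewrite bin0n /= mul0r scale0r.
  by rewrite bin0 expr0 mulr1 scale1r.
rewrite iterS; set Z := iter p _ X.
rewrite {1}/Z (IH m.+1) ?(ltn_trans _ pm) // /Z (IH m) //.
rewrite (superop_sum _ _ lS) scaler_sumr big_ord_recl [RHS]big_ord_recl /= !bin0 -addrA.
congr (_ + _); rewrite -big_split; apply: eq_bigr => k _ /=.
rewrite (superopZ _ _ lS) scalerA -scalerDl /bump /= add1n binS natrD mulrDl.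
congr (_ *: _); rewrite -realc_affine; congr (real_complex _ (_ + _)).
by rewrite exprS mulrCA.
Qed.

Lemma trbnd_exp_euler N K (S : superop R N) t p X c :
  0 <= t -> 0 <= K -> (0 < p)%N -> linear S -> trbounded K S -> trbnd X c ->
  trbnd (exp_superop t S X - iter p (fun Y => Y + (t / p%:R)%:C *: S Y) X)
    (expR (t * K) * (t * K) ^+ 2 / p%:R * c).
Proof.
move=> t0 K0 p0 lS hS hX.
pose be k : R := 'C(p, k)%:R * (t / p%:R) ^+ k.
have pp : 0 < p%:R :> R by rewrite ltr0n.
apply: trbnd_le (trbnd_exp_dominated (be := be) (m0 := p.+1) t0 K0 hS hX _ _).
- rewrite ler_wpM2r ?(trbnd_ge0 hX) //.
  have -> : \sum_(k < p.+1) be k * K ^+ k = (1 + t * K / p%:R) ^+ p.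
    rewrite exprDn; apply: eq_bigr => k _; rewrite expr1n mul1r -mulr_natl /be.
    by rewrite -[LHS]mulrA -exprMn mulrAC.
  by apply: expR_euler; rewrite ?mulr_ge0.
- move=> k; rewrite /be mulr_ge0 ?exprn_ge0 ?divr_ge0 //= expr_div_n mulrCA.
  rewrite ler_wpM2l ?exprn_ge0 // ler_pdivrMr ?exprn_gt0 // mulrC.
  rewrite ler_pdivlMr ?ltr0n ?fact_gt0 // -natrM -natrX ler_nat bin_ffact.
  exact: ffact_le_expn.
- by move=> m pm; exact: iter_euler.
Qed.

End SuperExponential.

(** * Integration of bounded complex functions *)

Section BoundedMeasurable.
Context {R : realType} {d : measure_display} {T : measurableType d}.
Variable P : probability T R.
Implicit Types f g : T -> R[i].

(** Unlike integrability, boundedness survives products, and on a probability space it implies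
    integrability. *)
Definition bounded_mfun f : Prop :=
  [/\ measurable_fun setT (fun x => complex.Re (f x)),
      measurable_fun setT (fun x => complex.Im (f x))
    & exists B : R, forall x, normc (f x) <= B].

Lemma ReD (z w : R[i]) : complex.Re (z + w) = complex.Re z + complex.Re w.
Proof. by case: z w => ? ? []. Qed.

Lemma ImD (z w : R[i]) : complex.Im (z + w) = complex.Im z + complex.Im w.
Proof. by case: z w => ? ? []. Qed.

Lemma ReM (z w : R[i]) : complex.Re (z * w) =
  complex.Re z * complex.Re w - complex.Im z * complex.Im w.
Proof. by case: z w => ? ? []. Qed.

Lemma ImM (z w : R[i]) : complex.Im (z * w) =
  complex.Re z * complex.Im w + complex.Im z * complex.Re w.
Proof. by case: z w => ? ? []. Qed.

Lemma complex_ext (z w : R[i]) :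
  complex.Re z = complex.Re w -> complex.Im z = complex.Im w -> z = w.
Proof. by case: z w => ? ? [] ? ? /= -> ->. Qed.

Lemma bounded_mfun_cst (k : R[i]) : bounded_mfun (fun=> k).
Proof. by split; [exact: measurable_cst|exact: measurable_cst|exists (normc k)]. Qed.

Lemma bounded_mfunD f g : bounded_mfun f -> bounded_mfun g ->
  bounded_mfun (fun x => f x + g x).
Proof.
move=> [mf mf' [B hB]] [mg mg' [B' hB']]; split.
- by under eq_fun do rewrite ReD; exact: measurable_funD.
- by under eq_fun do rewrite ImD; exact: measurable_funD.
- by exists (B + B') => x; apply: le_trans (le_normcD _ _) _; exact: lerD.
Qed.

Lemma bounded_mfunM f g : bounded_mfun f -> bounded_mfun g ->
  bounded_mfun (fun x => f x * g x).
Proof.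
move=> [mf mf' [B hB]] [mg mg' [B' hB']]; split.
- by under eq_fun do rewrite ReM; apply: measurable_funB; exact: measurable_funM.
- by under eq_fun do rewrite ImM; apply: measurable_funD; exact: measurable_funM.
- exists (B * B') => x; rewrite Normc.normcM.
  by apply: ler_pM; rewrite ?normc_ge0.
Qed.

Lemma bounded_mfun_sum (I : Type) (s : seq I) (f : I -> T -> R[i]) :
  (forall i, bounded_mfun (f i)) -> bounded_mfun (fun x => \sum_(i <- s) f i x).
Proof.
move=> h; elim: s => [|i s IH].
  by under eq_fun do rewrite big_nil; exact: bounded_mfun_cst.
by under eq_fun do rewrite big_cons; exact: bounded_mfunD.
Qed.

Lemma bounded_mfun_real (f : T -> R) (B : R) : measurable_fun setT f ->
  (forall x, `|f x| <= B) -> bounded_mfun (fun x => (f x)%:C).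
Proof.
move=> mf hB; split; [exact: mf| |by exists B => x; rewrite normcR].
exact: (@measurable_cst _ _ _ _ setT (0 : R)).
Qed.

Lemma bounded_mfun_indic (D : set T) : measurable D ->
  bounded_mfun (fun x => (\1_D x : R)%:C).
Proof.
move=> mD; apply: (@bounded_mfun_real _ 1); first exact: measurable_indic.
by move=> x; rewrite indicE; case: (_ \in _); rewrite ?normr1 ?normr0.
Qed.

Lemma integrable_bounded (f : T -> R) (B : R) : measurable_fun setT f ->
  (forall x, `|f x| <= B) -> P.-integrable setT (EFin \o f).
Proof.
move=> mf hB; apply: measurable_bounded_integrable; [exact: measurableT| |exact: mf|].
  by rewrite (le_lt_trans (probability_le1 P measurableT)) ?ltry.
exists B; split; first exact: num_real.
by move=> y By x _; apply: le_trans (hB x) _; exact: ltW.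
Qed.

Lemma integrable_Re f : bounded_mfun f ->
  P.-integrable setT (EFin \o (fun x => complex.Re (f x))).
Proof.
move=> [mf _ [B hB]]; apply: (integrable_bounded (B := B)) => // x.
by apply: le_trans (hB x); exact: ler_normcRe.
Qed.

Lemma integrable_Im f : bounded_mfun f ->
  P.-integrable setT (EFin \o (fun x => complex.Im (f x))).
Proof.
move=> [_ mf [B hB]]; apply: (integrable_bounded (B := B)) => // x.
by apply: le_trans (hB x); exact: ler_normcIm.
Qed.

Lemma cintegralD f g : bounded_mfun f -> bounded_mfun g ->
  cintegral P (fun x => f x + g x) = cintegral P f + cintegral P g.
Proof.
move=> hf hg; apply: complex_ext; rewrite /cintegral ?ReD ?ImD /=.
- under eq_Rintegral do rewrite ReD.
  by rewrite RintegralD //; exact: integrable_Re.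
- under eq_Rintegral do rewrite ImD.
  by rewrite RintegralD //; exact: integrable_Im.
Qed.

Lemma integrableZ (k : R) (f : T -> R) : P.-integrable setT (EFin \o f) ->
  P.-integrable setT (EFin \o (fun x => k * f x)).
Proof. by move=> h; have := integrableZl measurableT k h. Qed.

Lemma cintegralZ (k : R[i]) f : bounded_mfun f ->
  cintegral P (fun x => k * f x) = k * cintegral P f.
Proof.
move=> hf; have hR := integrable_Re hf; have hI := integrable_Im hf.
apply: complex_ext; rewrite ?ReM ?ImM /cintegral /=.
- under eq_Rintegral do rewrite ReM.
  by rewrite RintegralB ?RintegralZl //; exact: integrableZ.
- under eq_Rintegral do rewrite ImM.
  by rewrite RintegralD ?RintegralZl //; exact: integrableZ.
Qed.

Lemma cintegral_cst (k : R[i]) : cintegral P (fun=> k) = k.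
Proof.
by apply: complex_ext; rewrite /cintegral /= Rintegral_cst // [X in fine X]probability_setT mulr1.
Qed.

Lemma cintegral_sum (I : Type) (s : seq I) (f : I -> T -> R[i]) :
  (forall i, bounded_mfun (f i)) ->
  cintegral P (fun x => \sum_(i <- s) f i x) = \sum_(i <- s) cintegral P (f i).
Proof.
move=> h; elim: s => [|i s IH].
  by under eq_fun do rewrite big_nil; rewrite big_nil cintegral_cst.
under eq_fun do rewrite big_cons.
by rewrite big_cons cintegralD ?IH //; exact: bounded_mfun_sum.
Qed.

Lemma cintegral_indic (D : set T) : measurable D ->
  cintegral P (fun x => (\1_D x : R)%:C) = (fine (P D))%:C.
Proof.
move=> mD; apply: complex_ext; rewrite /cintegral /=.
  by rewrite /Rintegral integral_indic // setIT.
by rewrite Rintegral_cst // mul0r.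
Qed.

(** After multiplication by a phase the integral is a nonnegative real, and the real part of the
    integrand is at most B. *)
Lemma cintegral_le f (B : R) : bounded_mfun f -> (forall x, normc (f x) <= B) ->
  normc (cintegral P f) <= B.
Proof.
move=> hf hB; have [u u1 uE] := unimodular_normc (cintegral P f).
have -> : normc (cintegral P f) = complex.Re (cintegral P (fun x => u * f x)).
  by rewrite cintegralZ // uE.
rewrite -[leRHS](_ : Rintegral P setT (fun=> B) = B); last first.
  by rewrite Rintegral_cst // [X in fine X]probability_setT mulr1.
apply: le_Rintegral => //.
- by apply: integrable_Re; apply: bounded_mfunM hf; exact: bounded_mfun_cst.
- apply: (integrable_bounded (B := `|B|)) => //; exact: measurable_cst.
- move=> x _; apply: le_trans (ler_norm _) _; apply: le_trans (ler_normcRe _) _.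
  by rewrite Normc.normcM u1 mul1r.
Qed.

End BoundedMeasurable.

(** * Factorisation of expectations, from events to functions *)

Section Independence.
Context {R : realType} {d d' : measure_display} {W : measurableType d}
  {A : measurableType d'}.

Lemma bounded_mfun_comp (P : probability W R) (X : {RV P >-> A}) (g : A -> R[i]) :
  bounded_mfun g -> bounded_mfun (fun w => g (X w)).
Proof.
move=> [mg mg' [B hB]]; split; last by exists B.
- exact: (measurableT_comp mg (measurable_funPT X)).
- exact: (measurableT_comp mg' (measurable_funPT X)).
Qed.

Lemma eq0_geometric (x K : R) : 0 <= x -> (forall n, x <= K / 2 ^+ n) -> x = 0.
Proof.
move=> x0 h; apply/eqP; rewrite eq_le x0 andbT leNgt; apply/negP => xp.
have K0 : 0 <= K by apply: le_trans x0 _; have := h 0%N; rewrite expr0 divr1.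
have := archi_boundP (divr_ge0 K0 x0); set n := Num.bound _ => hn.
have := h n; apply/negP; rewrite -ltNge ltr_pdivrMr ?exprn_gt0 // -ltr_pdivrMl //.
rewrite mulrC; apply: lt_trans hn _.
by rewrite -natrX ltr_nat ltn_expl.
Qed.

(* For g with values in [0, 1], g = 1_S / 2 + g' / 2 with S = {g >= 1/2} and
   g' = 2 g - 1_S again with values in [0, 1]. The defect of the formula is linear
   in g, vanishes on indicators and is bounded on [0, 1]-valued functions, so each
   such step halves it and it is 0. *)
Lemma cintegral_independent (P : probability W R) (mu : probability A R)
    (X : {RV P >-> A}) (h : W -> R[i]) (c : R[i]) :
  bounded_mfun h ->
  (forall B, measurable B -> cintegral P (fun w => h w * (\1_B (X w) : R)%:C) =
                         c * (fine (mu B))%:C) ->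
  forall g, bounded_mfun g ->
  cintegral P (fun w => h w * g (X w)) = c * cintegral mu g.
Proof.
move=> hh hB.
pose D (g : A -> R[i]) := cintegral P (fun w => h w * g (X w)) - c * cintegral mu g.
suff D0 : forall g, bounded_mfun g -> D g = 0.
  by move=> g hg; apply/eqP; rewrite -subr_eq0; apply/eqP/D0.
have bX (g : A -> R[i]) : bounded_mfun g -> bounded_mfun (fun w => h w * g (X w)).
  by move=> hg; apply: bounded_mfunM => //; exact: bounded_mfun_comp.
have DD (g g' : A -> R[i]) : bounded_mfun g -> bounded_mfun g' ->
    D (fun a => g a + g' a) = D g + D g'.
  move=> hg hg'; rewrite /D; under eq_fun do rewrite mulrDr.
  by rewrite !cintegralD //; [ring|exact: bX|exact: bX].
have DZ (k : R[i]) (g : A -> R[i]) : bounded_mfun g -> D (fun a => k * g a) = k * D g.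
  move=> hg; rewrite /D; under eq_fun do rewrite mulrCA.
  by rewrite !cintegralZ //; [ring|exact: bX].
have D1 S : measurable S -> D (fun a => (\1_S a : R)%:C) = 0.
  by move=> mS; rewrite /D hB // cintegral_indic // subrr.
have [_ _ [Bh hBh]] := hh.
pose K := Bh + normc c.
have key n (g : A -> R) : measurable_fun setT g -> (forall a, 0 <= g a <= 1) ->
    normc (D (fun a => (g a)%:C)) <= K / 2 ^+ n.
  have n1 (g' : A -> R) : (forall a, 0 <= g' a <= 1) -> forall a, `|g' a| <= 1.
    by move=> g01 a; have /andP[? ?] := g01 a; rewrite ger0_norm.
  elim: n g => [|n IH] g mg g01.
    have bg : bounded_mfun (fun a => (g a)%:C) by apply: (bounded_mfun_real mg (n1 _ g01)).
    rewrite expr0 divr1; apply: le_trans (le_normcB _ _) _; apply: lerD.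
      apply: cintegral_le; first exact: (bX _ bg).
      move=> w; rewrite Normc.normcM normcR; apply: le_trans (hBh w).
      by rewrite ler_piMr ?normc_ge0 ?n1.
    rewrite Normc.normcM ler_piMr ?normc_ge0 //; apply: cintegral_le => // a.
    by rewrite normcR n1.
  pose S := g @^-1` `[2^-1, +oo[%classic.
  have mS : measurable S by rewrite -[S]setTI; exact: mg.
  have SE a : (\1_S a : R) = if 2^-1 <= g a then 1 else 0.
    rewrite indicE -mulrb; congr (_ *+ nat_of_bool _); apply/idP/idP.
      by rewrite inE /S /= in_itv /= andbT.
    by move=> ha; rewrite inE /S /= in_itv /= andbT.
  pose g' a : R := 2 * g a - \1_S a.
  have mg' : measurable_fun setT g'.
    by apply: measurable_funB; [exact: measurable_funM|exact: measurable_indic].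
  have g'01 a : 0 <= g' a <= 1.
    have /andP[ga0 ga1] := g01 a; rewrite /g' SE.
    by case: (leP 2^-1 (g a)) => ha; apply/andP; split; lra.
  have bg' : bounded_mfun (fun a => (g' a)%:C) by apply: (bounded_mfun_real mg' (n1 _ g'01)).
  have -> : (fun a => (g a)%:C) =
      (fun a => 2^-1%:C * (\1_S a : R)%:C + 2^-1%:C * (g' a)%:C).
    apply/funext => a; rewrite -!rmorphM -rmorphD /=; congr (real_complex _ _).
    by rewrite /g'; field.
  have bS := bounded_mfun_indic (R := R) mS.
  rewrite DD ?DZ //; try by apply: bounded_mfunM => //; exact: bounded_mfun_cst.
  rewrite D1 // mulr0 add0r Normc.normcM normcR ger0_norm ?invr_ge0 //.
  by rewrite exprS invfM mulrCA ler_wpM2l ?invr_ge0 // IH.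
have key0 (g : A -> R) : measurable_fun setT g -> (forall a, 0 <= g a <= 1) ->
    D (fun a => (g a)%:C) = 0.
  move=> mg g01; apply: Normc.eq0_normc; apply: (@eq0_geometric _ K).
    exact: normc_ge0.
  by move=> n; exact: key.
have D1cst : D (fun=> 1) = 0.
  have -> : (fun=> 1) = (fun a : A => (\1_setT a : R)%:C).
    by apply/funext => a; rewrite indicT.
  exact: D1.
have keyr (g : A -> R) (B : R) : measurable_fun setT g -> (forall a, `|g a| <= B) ->
    D (fun a => (g a)%:C) = 0.
  (* An affine change maps [-B', B'] to [0, 1], and constants have zero defect; adding 1 keeps B'
     positive. *)
  move=> mg gB; pose B' := `|B| + 1.
  have B'0 : 0 < B' by rewrite ltr_pwDr.
  have gB' a : `|g a| <= B' by apply: le_trans (gB a) _; rewrite ler_wpDr // ler_norm.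
  pose g' a := (2 * B')^-1 * (g a + B').
  have mg' : measurable_fun setT g'.
    by apply: measurable_funM => //; exact: measurable_funD.
  have g'01 a : 0 <= g' a <= 1.
    have := gB' a; rewrite ler_norml => /andP[h1 h2].
    rewrite /g' mulrC divr_ge0 ?ler_pdivrMr ?mulr_gt0 //=; lra.
  have -> : (fun a => (g a)%:C) =
      (fun a => (2 * B')%:C * (g' a)%:C + (- B')%:C * 1).
    apply/funext => a; rewrite mulr1 -rmorphM -rmorphD /=; congr (real_complex _ _).
    by rewrite /g'; field; rewrite gt_eqF.
  have bg' : bounded_mfun (fun a => (g' a)%:C).
    by apply: (bounded_mfun_real (B := 1) mg') => a; have /andP[? ?] := g'01 a; rewrite ger0_norm.
  have b1 := bounded_mfun_cst (T := A) (1 : R[i]).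
  rewrite DD ?DZ //; try by apply: bounded_mfunM => //; exact: bounded_mfun_cst.
  by rewrite D1cst key0 // !mulr0 addr0.
move=> g [mg mg' [B gB]].
have -> : g = (fun a => (complex.Re (g a))%:C + 'i%C * (complex.Im (g a))%:C).
  by apply/funext => a; rewrite -complexE.
have h1 a : `|complex.Re (g a)| <= B by apply: le_trans (gB a); exact: ler_normcRe.
have h2 a : `|complex.Im (g a)| <= B by apply: le_trans (gB a); exact: ler_normcIm.
have b1 := bounded_mfun_real mg h1; have b2 := bounded_mfun_real mg' h2.
rewrite DD ?DZ //; last by apply: bounded_mfunM => //; exact: bounded_mfun_cst.
by rewrite (keyr _ _ mg h1) (keyr _ _ mg' h2) mulr0 addr0.
Qed.

End Independence.

(** * The expectation of a random product of maps *)

Section Path.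
Context {R : realType} {d d' : measure_display} {W : measurableType d}
  {A : measurableType d'}.
Variables (P : probability W R) (mu : probability A R) (N : nat).
Variables (G : A -> superop R N).
Hypothesis linG : forall a, linear (G a).
Hypothesis mG : measurable_superop G.
Hypothesis bG : exists B : R, forall a k l i j, normc (G a (delta_mx k l) i j) <= B.

Lemma bounded_mfun_superop X i j : bounded_mfun (fun a => G a X i j).
Proof.
have [B hB] := bG; have [m1 m2] := mG X i j; split => //.
exists (\sum_(k < N) \sum_(l < N) (\sum_p \sum_q normc (X p q)) * B) => a.
apply: superop_entry_le => // k l.
rewrite (bigD1 k) //= (bigD1 l) //= -addrA lerDl addr_ge0 // sumr_ge0 // => p _.
  exact: normc_ge0.
by rewrite sumr_ge0 // => q _; exact: normc_ge0.
Qed.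

Lemma avg_superop_entry X i j : avg_superop mu G X i j =
  \sum_k \sum_l X k l * cintegral mu (fun a => G a (delta_mx k l) i j).
Proof.
rewrite mxE; under eq_fun do rewrite superop_entry //.
rewrite cintegral_sum => [|k]; last first.
  apply: bounded_mfun_sum => l; apply: bounded_mfunM; first exact: bounded_mfun_cst.
  exact: bounded_mfun_superop.
apply: eq_bigr => k _; rewrite cintegral_sum => [|l]; last first.
  by apply: bounded_mfunM; [exact: bounded_mfun_cst|exact: bounded_mfun_superop].
by apply: eq_bigr => l _; rewrite cintegralZ //; exact: bounded_mfun_superop.
Qed.

Variables (I : finType) (X : I -> {RV P >-> A}).
Hypothesis iidX : iid_samples mu X.
Variable rho : op R N.

Local Notation Y s w := (compose_path G [seq X i w | i <- s] rho).

(** The last sample acts last, so it splits off: finite sums of a function of the earlier samples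
    times a function of [X x]. *)
Lemma compose_path_rcons s x w i j : Y (rcons s x) w i j =
  \sum_k \sum_l Y s w k l * G (X x w) (delta_mx k l) i j.
Proof.
by rewrite map_rcons /compose_path foldl_rcons superop_entry.
Qed.

Lemma bounded_mfun_path s i j : bounded_mfun (fun w => Y s w i j).
Proof.
elim/last_ind: s i j => [|s x IH] i j; first exact: bounded_mfun_cst.
under eq_fun do rewrite compose_path_rcons.
apply: bounded_mfun_sum => k; apply: bounded_mfun_sum => l.
apply: bounded_mfunM => //; apply: (bounded_mfun_comp (X x) (g := fun a => G a (delta_mx k l) i j)).
exact: bounded_mfun_superop.
Qed.

Let indJ (J : {set I}) (B : I -> set A) (w : W) : R :=
  \prod_(i in J) \1_(B i) (X i w).

(** Independence is given for events only. The indicator of an event in samples outside [s]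
    strengthens the statement enough for induction on [s]. *)
Lemma cintegral_path_indic s (J : {set I}) (B : I -> set A) i j :
  (forall i, measurable (B i)) -> uniq s -> (forall i, i \in s -> i \notin J) ->
  cintegral P (fun w => Y s w i j * (indJ J B w)%:C) =
  iter (size s) (avg_superop mu G) rho i j * (\prod_(i in J) fine (mu (B i)))%:C.
Proof.
move=> mB; have [ind idd] := iidX.
have indE (K : {set I}) (C : I -> set A) w :
    indJ K C w = \1_(\bigcap_(i in [set` K]) (X i @^-1` C i)) w.
  rewrite indicE /indJ; have [wK|wK] := boolP (w \in _).
    rewrite big1 // => k kK; rewrite indicE mem_set //.
    by move: wK; rewrite inE => /(_ k kK).
  apply/eqP; rewrite prodf_seq_eq0; apply/hasP.
  apply: contrapT => hn; move/negP: wK; apply; rewrite inE => k /= kK.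
  apply: contrapT => hk; apply: hn; exists k; first exact: mem_index_enum.
  by rewrite kK indicE memNset //= eqxx.
have mcap (K : {set I}) (C : I -> set A) : (forall i, measurable (C i)) ->
    measurable (\bigcap_(i in [set` K]) (X i @^-1` C i)).
  move=> mC; apply: fin_bigcap_measurable => [|k _]; first exact: finite_finset.
  by rewrite -[X in measurable X]setTI; apply: measurable_funPT.
have bind (K : {set I}) (C : I -> set A) : (forall i, measurable (C i)) ->
    bounded_mfun (fun w => (indJ K C w)%:C).
  by move=> mC; under eq_fun do rewrite indE; exact: bounded_mfun_indic (mcap _ _ mC).
elim/last_ind: s J B mB i j => [|s x IH] J B mB i j.
  move=> _ _; rewrite cintegralZ; last exact: bind.
  congr (_ * _); under eq_fun do rewrite indE.
  rewrite cintegral_indic; last exact: mcap.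
  rewrite ind //; congr (real_complex _ _).
  have -> : (\prod_(k in J) P (X k @^-1` B k))%E = (\prod_(k in J) fine (mu (B k)))%:E.
    elim/big_rec2: _ => // k y z _ ->.
    rewrite EFinM; congr (_ * _)%E.
    by rewrite fineK ?fin_num_measure // -(idd k).
  by [].
rewrite rcons_uniq => /andP[xs us] dJ.
have xJ : x \notin J by apply: dJ; rewrite mem_rcons mem_head.
rewrite size_rcons iterS avg_superop_entry mulr_suml.
have eqf : (fun w => Y (rcons s x) w i j * (indJ J B w)%:C) = (fun w =>
    \sum_k \sum_l Y s w k l * (indJ J B w)%:C * G (X x w) (delta_mx k l) i j).
  apply/funext => w; rewrite compose_path_rcons mulr_suml; apply: eq_bigr => k _.
  by rewrite mulr_suml; apply: eq_bigr => l _; rewrite mulrAC.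
have bterm k l : bounded_mfun (fun w =>
    Y s w k l * (indJ J B w)%:C * G (X x w) (delta_mx k l) i j).
  apply: bounded_mfunM; first by apply: bounded_mfunM; [exact: bounded_mfun_path|exact: bind].
  apply: (bounded_mfun_comp (X x) (g := fun a => G a (delta_mx k l) i j)).
  exact: bounded_mfun_superop.
rewrite eqf cintegral_sum => [|k]; last by apply: bounded_mfun_sum.
apply: eq_bigr => k _; rewrite cintegral_sum // mulr_suml; apply: eq_bigr => l _.
rewrite (@cintegral_independent _ _ _ _ _ P mu (X x)
  (fun w => Y s w k l * (indJ J B w)%:C)
  (iter (size s) (avg_superop mu G) rho k l * (\prod_(y in J) fine (mu (B y)))%:C)
  _ _ (fun a => G a (delta_mx k l) i j)).
- by rewrite mulrAC.
- by apply: bounded_mfunM; [exact: bounded_mfun_path|exact: bind].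
(* The event that [X x] lies in [C] joins the indicator, and the induction hypothesis is used with x
   added to [J]. *)
- move=> C mC; pose B' y := if y == x then C else B y.
  have mB' y : measurable (B' y) by rewrite /B'; case: eqP.
  have B'J y : y \in J -> B' y = B y.
    by move=> yJ; rewrite /B'; case: eqP => // yx; move: xJ; rewrite -yx yJ.
  have := IH (x |: J) B' mB' k l us.
  have -> : (\prod_(y in x |: J) fine (mu (B' y))) =
      fine (mu C) * \prod_(y in J) fine (mu (B y)).
    rewrite big_setU1 //= /B' eqxx; congr (_ * _); apply: eq_bigr => y yJ.
    by rewrite -/(B' y) B'J.
  have -> : (fun w => Y s w k l * (indJ (x |: J) B' w)%:C) =
      (fun w => Y s w k l * (indJ J B w)%:C * (\1_C (X x w) : R)%:C).
    apply/funext => w; rewrite -mulrA -rmorphM /=; congr (_ * real_complex _ _).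
    rewrite /indJ big_setU1 //= /B' eqxx mulrC; congr (_ * _); apply: eq_bigr => y yJ.
    by rewrite -/(B' y) B'J.
  move=> ->; first by rewrite rmorphM /= [RHS]mulrAC mulrA.
  move=> y ys; rewrite !inE negb_or dJ ?mem_rcons ?inE ?ys ?orbT // andbT.
  by apply: contraNneq xs => <-.
- exact: bounded_mfun_superop.
Qed.

Lemma cintegral_path s i j : uniq s ->
  cintegral P (fun w => Y s w i j) = iter (size s) (avg_superop mu G) rho i j.
Proof.
move=> us; have := @cintegral_path_indic s finset.set0 (fun=> setT) i j.
rewrite big_set0 mulr1 => <- //; last by move=> k _; rewrite inE.
by congr cintegral; apply/funext => w; rewrite /indJ big_set0 mulr1.
Qed.

End Path.

(** * Accumulation of one-step errors *)

Section Telescope.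
Context {R : realType}.

Lemma iter_linear N (S : superop R N) k : linear S -> linear (iter k S).
Proof. by move=> lS; elim: k => // k IH a X Y; rewrite !iterS IH; exact: lS. Qed.

(** Fb - Gp is evaluated on the state Fb^k rho, the only kind of operator where it is controlled;
    the linear Gp then acts on the accumulated difference, which is not a state. *)
Lemma trbnd_telescope N (Fb Gp : superop R N) (q e : R) rho k :
  linear Gp -> 1 <= q -> trbounded q Gp ->
  (forall sigma, quantum_state sigma -> quantum_state (Fb sigma)) ->
  (forall sigma, quantum_state sigma -> trbnd (Fb sigma - Gp sigma) e) ->
  quantum_state rho ->
  trbnd (iter k Fb rho - iter k Gp rho) (k%:R * e * q ^+ k).
Proof.
move=> lG q1 hG sF hFG hrho.
have e0 : 0 <= e by apply: trbnd_ge0 (hFG _ hrho).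
have sk j : quantum_state (iter j Fb rho) by elim: j => // j IH; rewrite iterS; exact: sF.
elim: k => [|k IH]; first by rewrite subrr mul0r mul0r; exact: trbnd0.
have -> : iter k.+1 Fb rho - iter k.+1 Gp rho =
    (Fb (iter k Fb rho) - Gp (iter k Fb rho)) + Gp (iter k Fb rho - iter k Gp rho).
  by rewrite !iterS (superopB _ _ lG) addrA subrK.
apply: trbnd_le (trbndD (hFG _ (sk k)) (hG _ _ IH)).
have -> : k.+1%:R * e * q ^+ k.+1 = e * q ^+ k.+1 + q * (k%:R * e * q ^+ k).
  by rewrite -natr1 exprS; ring.
by rewrite lerD2r ler_peMr // exprn_ege1.
Qed.

(** 1 + w <= exp w, and the total exponent w p M = 5 (tau lambda)^2 M / p is at most 1. *)
Lemma expR1_bound (lambda tau : R) M p : (0 < p)%N ->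
  5 * (tau * lambda) ^+ 2 * M%:R <= p%:R ->
  ((1 + 5 * (tau / p%:R) ^+ 2 * lambda ^+ 2) ^+ p) ^+ M <= expR 1.
Proof.
move=> p0 hp; have pp : 0 < p%:R :> R by rewrite ltr0n.
set w := 5 * _ ^+ 2 * _; have w0 : 0 <= w.
  by apply: mulr_ge0 (sqr_ge0 _); apply: mulr_ge0 (sqr_ge0 _).
rewrite -exprM; apply: (@le_trans _ _ (expR w ^+ (p * M))).
  by rewrite lerXn2r ?nnegrE ?expR_ge0 ?addr_ge0 ?expR_ge1Dx.
rewrite -expRM_natr ler_expR.
have -> : w * (p * M)%:R = 5 * (tau * lambda) ^+ 2 * M%:R / p%:R.
  by rewrite /w natrM; field; rewrite gt_eqF.
by rewrite ler_pdivrMr // mul1r.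
Qed.

(* The semigroup exp (t S) is approximated by the Euler scheme (1 + (tau/p) S)^(pM):
   its powers are bounded uniformly by expR 1 as soon as p is large, so the
   telescoping sum does not need that exp (t S) is a contraction. *)
Lemma trbnd_repeated N (Fb S : superop R N) lambda tau M D rho :
  0 < lambda -> 0 < tau -> (0 < M)%N ->
  linear S -> quasi_dissipative lambda S ->
  (forall sigma, quantum_state sigma -> quantum_state (Fb sigma)) ->
  (forall sigma, quantum_state sigma ->
     trbnd (Fb sigma - (sigma + tau%:C *: S sigma)) D) ->
  quantum_state rho ->
  let x := tau * (7 * lambda) in
  trbnd (iter M Fb rho - exp_superop (tau * M%:R) S rho)
    (M%:R * (D + 2 * (x ^+ 2 * expR x)) * expR 1).
Proof.
move=> l0 t0 M0 lS dS sF hF hrho x.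
have K0 : 0 <= 7 * lambda by rewrite mulr_ge0 // ltW.
have bS : trbounded (7 * lambda) S by move=> X c; exact: quasi_dissipative_bound.
have x0 : 0 <= x by rewrite mulr_ge0 // ltW.
have MR : 0 < M%:R :> R by rewrite ltr0n.
have xx0 := mulr_ge0 (sqr_ge0 x) (expR_ge0 x).
set e := D + _.
have e0 : 0 <= e.
  by apply: addr_ge0; [exact: trbnd_ge0 (hF _ hrho)|exact: mulr_ge0].
(* The slack [dl] absorbs the distance from the Euler scheme to the exponential at the final
   time. *)
move=> A b b0 hA; apply/ler_addgt0Pr => dl dl0.
set y := tau * M%:R * (7 * lambda).
have y0 : 0 <= y by rewrite !mulr_ge0 // ltW.
have h1 := archi_boundP (mulr_ge0 (mulr_ge0 (ler0n R 5) (sqr_ge0 (tau * lambda))) (ltW MR)).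
have h2 := archi_boundP (divr_ge0 (mulr_ge0 b0 (mulr_ge0 (expR_ge0 y) (sqr_ge0 y))) (ltW dl0)).
set n1 := Num.bound _ in h1; set n2 := Num.bound _ in h2.
(* [n1] secures the uniform bound on powers, [n2] brings the final Euler error below [dl]; the
   successor makes p positive. *)
pose p := (n1 + n2).+1; have p0 : (0 < p)%N by [].
have pp : 0 < p%:R :> R by rewrite ltr0n.
have p1 : 5 * (tau * lambda) ^+ 2 * M%:R <= p%:R.
  by apply: le_trans (ltW h1) _; rewrite ler_nat /p leqW // leq_addr.
have p2 : b * (expR y * y ^+ 2) / dl <= p%:R.
  by apply: le_trans (ltW h2) _; rewrite ler_nat /p leqW // leq_addl.
pose f (Y : op R N) := Y + (tau / p%:R)%:C *: S Y.
have s0 : 0 <= tau / p%:R by rewrite divr_ge0 // ltW.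
have lf : linear f.
  move=> a X Y; rewrite /f lS !scalerDr !scalerA -!addrA; congr (_ + _).
  by rewrite addrCA mulrC.
set q := 1 + 5 * (tau / p%:R) ^+ 2 * lambda ^+ 2.
have q1 : 1 <= q.
  by rewrite lerDl; apply: mulr_ge0 (sqr_ge0 _); apply: mulr_ge0 (sqr_ge0 _).
have bf : trbounded q f by move=> X c; exact: dS.
(* Through 1 + tau S and exp (tau S): one Taylor remainder and one Euler error, the latter bounded
   crudely with p >= 1. *)
have step sigma : quantum_state sigma -> trbnd (Fb sigma - iter p f sigma) e.
  move=> hs; have s1 := trbnd_state hs.
  have hT := trbnd_exp_taylor (ltW t0) K0 bS s1.
  have hE := trbnd_exp_euler (ltW t0) K0 p0 lS bS s1.
  have := trbndD (trbndD (hF _ hs) (trbndN hT)) hE.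
  rewrite opprB !subrKA; apply: trbnd_le.
  rewrite /e -addrA lerD2l !mulr1 -/x mulr2n mulrDl mul1r lerD2l ler_pdivrMr //.
  by rewrite [expR x * _]mulrC ler_peMr // ler1n.
have bp : trbounded (q ^+ p) (iter p f) by move=> X c; exact: trbnd_iter.
have tel := trbnd_telescope M (iter_linear p lf) (exprn_ege1 p q1) bp sF step hrho.
have Mp0 : (0 < M * p)%N by rewrite muln_gt0 M0.
have eul := trbnd_exp_euler (mulr_ge0 (ltW t0) (ltW MR)) K0
  Mp0 lS bS (trbnd_state hrho).
rewrite -/y mulr1 in eul.
(* The substep is the same, so M blocks of p substeps form the Euler scheme with M p steps at the
   final time. *)
have sE : tau * M%:R / (M * p)%:R = tau / p%:R.
  by rewrite natrM; field; rewrite !gt_eqF.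
rewrite sE iterM -/f in eul.
have := trbndD tel (trbndN eul); rewrite opprB addrA subrK => /(_ A b b0 hA).
move/le_trans; apply; rewrite mulrDr; apply: lerD.
  apply: ler_wpM2l => //; apply: ler_wpM2l; first exact: mulr_ge0 (ltW MR) e0.
  exact: expR1_bound.
rewrite natrM ler_pdivrMr // in p2 *.
rewrite mulrA ler_pdivrMr ?mulr_gt0 //; apply: le_trans p2 _.
rewrite [leRHS]mulrCA [leLHS]mulrC ler_peMl ?ler1n //.
by apply: mulr_ge0; exact: ltW.
Qed.

End Telescope.

(** * Averages of operator-valued functions *)

Section Average.
Context {R : realType} {d : measure_display} {A : measurableType d}.
Variable mu : probability A R.

Definition cintegral_mx N (Z : A -> op R N) : op R N :=
  \matrix_(i, j) cintegral mu (fun a => Z a i j).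

Definition bounded_mfun_mx N (Z : A -> op R N) : Prop :=
  forall i j, bounded_mfun (fun a => Z a i j).

Lemma bounded_mfun_mxP N (Z Z' : A -> op R N) k :
  bounded_mfun_mx Z -> bounded_mfun_mx Z' -> bounded_mfun_mx (fun a => k *: Z a + Z' a).
Proof.
move=> hZ hZ' i j.
rewrite (_ : (fun a => _) = (fun a => k * Z a i j + Z' a i j)); last first.
  by apply/funext => a; rewrite mxE [X in X + _]mxE.
by apply: bounded_mfunD => //; apply: bounded_mfunM => //; exact: bounded_mfun_cst.
Qed.

Lemma bounded_mfun_mx_cst N (X : op R N) : bounded_mfun_mx (fun=> X).
Proof. by move=> i j; exact: bounded_mfun_cst. Qed.

Lemma cintegral_mxP N (Z Z' : A -> op R N) k :
  bounded_mfun_mx Z -> bounded_mfun_mx Z' ->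
  cintegral_mx (fun a => k *: Z a + Z' a) = k *: cintegral_mx Z + cintegral_mx Z'.
Proof.
move=> hZ hZ'; apply/matrixP => i j; rewrite mxE [RHS]mxE [X in _ = X + _]mxE.
rewrite [X in _ = _ * X + _]mxE [X in _ = _ + X]mxE.
rewrite (_ : (fun a => _) = (fun a => k * Z a i j + Z' a i j)); last first.
  by apply/funext => a; rewrite mxE [X in X + _]mxE.
have hk : bounded_mfun (fun a => k * Z a i j).
  by apply: bounded_mfunM => //; exact: bounded_mfun_cst.
by rewrite cintegralD ?cintegralZ.
Qed.

Lemma cintegral_mx_cst N (X : op R N) : cintegral_mx (fun=> X) = X.
Proof. by apply/matrixP => i j; rewrite mxE cintegral_cst. Qed.

Lemma bounded_mfun_trace N (B : op R N) (Z : A -> op R N) : bounded_mfun_mx Z ->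
  bounded_mfun (fun a => \tr (B *m Z a)).
Proof.
move=> hZ; apply: bounded_mfun_sum => i.
rewrite (_ : (fun a => _) = (fun a => \sum_j B i j * Z a j i)); last first.
  by apply/funext => a; rewrite mxE.
by apply: bounded_mfun_sum => j; apply: bounded_mfunM => //; exact: bounded_mfun_cst.
Qed.

Lemma mxtrace_cintegral N (B : op R N) (Z : A -> op R N) : bounded_mfun_mx Z ->
  \tr (B *m cintegral_mx Z) = cintegral mu (fun a => \tr (B *m Z a)).
Proof.
move=> hZ; rewrite /mxtrace.
have h i j : bounded_mfun (fun a => B i j * Z a j i).
  by apply: bounded_mfunM => //; exact: bounded_mfun_cst.
rewrite (_ : (fun a => _) = (fun a => \sum_i \sum_j B i j * Z a j i)); last first.
  by apply/funext => a; apply: eq_bigr => i _; rewrite mxE.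
rewrite cintegral_sum => [|i]; last exact: bounded_mfun_sum.
apply: eq_bigr => i _; rewrite mxE cintegral_sum //; apply: eq_bigr => j _.
by rewrite mxE cintegralZ.
Qed.

(** The trace against a fixed operator commutes with the integral, which reduces the claim to a
    scalar one. *)
Lemma trbnd_cintegral N (Z : A -> op R N) c : bounded_mfun_mx Z ->
  (forall a, trbnd (Z a) c) -> trbnd (cintegral_mx Z) c.
Proof.
move=> hZ hc B b b0 hB; rewrite mxtrace_cintegral //.
apply: cintegral_le; first exact: bounded_mfun_trace.
by move=> a; exact: hc.
Qed.

Lemma cintegral_mx_state N (Z : A -> op R N) : bounded_mfun_mx Z ->
  (forall a, quantum_state (Z a)) -> quantum_state (cintegral_mx Z).
Proof.
move=> hZ hs; split=> [v|]; last first.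
  rewrite -[cintegral_mx Z]mul1mx mxtrace_cintegral //.
  rewrite (_ : (fun a => _) = (fun=> 1)) ?cintegral_cst //.
  by apply/funext => a; rewrite mul1mx; case: (hs a).
(* A quadratic form is a trace against v v^t*, so positivity passes to the integral. *)
have trv (X : op R N) : (v^t* *m X *m v) 0 0 = \tr (v *m v^t* *m X).
  by rewrite -[in RHS]mulmxA mxtrace_mulC /mxtrace big_ord1.
rewrite trv mxtrace_cintegral // /cintegral lecE /=.
have h a : 0 <= \tr (v *m v^t* *m Z a) by rewrite -trv; case: (hs a).
apply/andP; split.
  rewrite (_ : (fun x => _) = (fun=> 0)) ?Rintegral_cst ?mul0r //.
  by apply/funext => a; exact: ger0_Im.
by apply: Rintegral_ge0 => a _; have := h a; rewrite lecE => /andP[].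
Qed.

Lemma avg_superopE N (G : A -> superop R N) X :
  avg_superop mu G X = cintegral_mx (fun a => G a X).
Proof. by []. Qed.

Lemma avg_superop_linear N (G : A -> superop R N) :
  (forall a, linear (G a)) -> (forall X, bounded_mfun_mx (fun a => G a X)) ->
  linear (avg_superop mu G).
Proof.
move=> lG bG k X Y; rewrite !avg_superopE -cintegral_mxP //.
by congr cintegral_mx; apply/funext => a; exact: lG.
Qed.

(** As mu has total mass one, X + s (average of G_a X) is the average of X + s G_a X. *)
Lemma avg_quasi_dissipative N (G : A -> superop R N) lambda :
  (forall X, bounded_mfun_mx (fun a => G a X)) ->
  (forall a, quasi_dissipative lambda (G a)) ->
  quasi_dissipative lambda (avg_superop mu G).
Proof.
move=> bG dG s X c s0 hX; rewrite addrC avg_superopE -{2}(cintegral_mx_cst X).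
have hc := bounded_mfun_mx_cst X.
rewrite -cintegral_mxP //; apply: trbnd_cintegral; first exact: bounded_mfun_mxP.
by move=> a; rewrite addrC; exact: dG.
Qed.

End Average.

(** * Error bound for observables, with an explicit constant *)

Theorem corollary5 (R : realType) (c0 C0 : R) (hc0 : 0 < c0) (hC0 : 0 < C0) :
  exists2 C : R, 0 < C &
  forall (n : nat)
    (d : measure_display) (A : measurableType d) (mu : probability A R)
    (H V : A -> op R (2 ^ n)) (lambda : R)
    (F : R -> A -> superop R (2 ^ n)) (tau T : R) (M : nat),
  let L := fun a : A => lindbladian (H a) (V a) in
  let Lbar := avg_superop mu L in
  (forall a : A, H a \is hermsymmx) ->
  measurable_superop L ->
  0 < lambda ->
  (forall a : A, spectral_norm (H a) <= lambda) ->
  (forall a : A, spectral_norm (V a) ^+ 2 <= lambda) ->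
  0 < tau -> tau <= c0 * lambda^-1 ->
  (forall a : A, quantum_channel (F tau a)) ->
  measurable_superop (F tau) ->
  (forall a : A,
     diamond_norm (fun X => F tau a X - exp_superop tau (L a) X)
     <= C0 * lambda ^+ 2 * tau ^+ 2) ->
  (1 <= M)%N -> T = tau * M%:R ->
  forall (d' : measure_display) (W : measurableType d')
    (P : probability W R) (a_ : 'I_M -> {RV P >-> A}),
  iid_samples mu a_ ->
  forall rho O : op R (2 ^ n),
  quantum_state rho -> O \is hermsymmx ->
  Normc.normc
    (cintegral P (fun w =>
       expval O (compose_path (F tau) [seq a_ i w | i <- enum 'I_M] rho))
     - expval O (exp_superop T Lbar rho))
  <= C * spectral_norm O * (lambda ^+ 2 * T ^+ 2 / M%:R).
Proof.
(* The Taylor remainders carry exp (7 lambda tau), and lambda tau <= c0. *)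
pose E := expR (7 * c0).
(* 147 = 3 * 49: three remainders (7 lambda tau)^2, one for each exp (tau L_a) and two from
   comparing exp (tau Lbar) with Euler substeps. The factor [expR 1] bounds the powers of the Euler
   scheme. *)
exists ((C0 + 147 * E) * expR 1).
  by rewrite mulr_gt0 ?expR_gt0 // addr_gt0 // mulr_gt0 // expR_gt0.
move=> n d A mu H V lambda F tau T M L Lbar hH mL l0 sH sV t0 tc chF mF dF M1 TE.
move=> d' W P a_ iid rho O hrho _.
have l0' := ltW l0; have t0' := ltW t0.
have dL a : quasi_dissipative lambda (L a).
  apply: lindbladian_quasi_dissipative => // u; apply: le_trans (sqn_spectral _ _) _;
    rewrite ler_wpM2r ?sqn_ge0 //.
  by rewrite lerXn2r ?nnegrE ?spectral_norm_ge0 //; exact: sH.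
have lL a : linear (L a) by exact: lindbladian_linear.
have K0 : 0 <= 7 * lambda by rewrite mulr_ge0.
have bL a : trbounded (7 * lambda) (L a) by move=> X c; exact: quasi_dissipative_bound.
have bmL X : bounded_mfun_mx (fun a => L a X).
  move=> i j; have [m1 m2] := mL X i j; split => //.
  exists (7 * lambda * trace_norm X) => a.
  by apply: trbnd_entry; apply: bL; exact: trbnd_trace_norm.
have lF a : linear (F tau a) by case: (chF a).
have bF : exists B : R, forall a k l i j, normc (F tau a (delta_mx k l) i j) <= B.
  by exists (2 ^ n)%:R => a k l i j; exact: channel_entry.
have bmF X : bounded_mfun_mx (fun a => F tau a X).
  by move=> i j; exact: bounded_mfun_superop.
have lS : linear Lbar by exact: avg_superop_linear.
have dS : quasi_dissipative lambda Lbar by exact: avg_quasi_dissipative.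
set Fbar := avg_superop mu (F tau).
have sF sigma : quantum_state sigma -> quantum_state (Fbar sigma).
  move=> hs; rewrite /Fbar avg_superopE; apply: cintegral_mx_state => // a.
  exact: channel_state.
pose x := tau * (7 * lambda).
have x0 : 0 <= x by rewrite mulr_ge0.
have step sigma : quantum_state sigma -> trbnd (Fbar sigma - (sigma + tau%:C *: Lbar sigma))
    (C0 * lambda ^+ 2 * tau ^+ 2 + x ^+ 2 * expR x).
  move=> hs; have s1 := trbnd_state hs.
  rewrite (_ : Fbar sigma - _ = cintegral_mx mu (fun a =>
      (- tau%:C) *: L a sigma + (1 *: F tau a sigma + - sigma))); last first.
    have hc := bounded_mfun_mx_cst (A := A) (- sigma).
    rewrite cintegral_mxP //; last exact: bounded_mfun_mxP.
    rewrite cintegral_mxP // cintegral_mx_cst scale1r scaleNr.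
    by rewrite opprD addrA addrC.
  apply: trbnd_cintegral.
    by apply: bounded_mfun_mxP => //; apply: bounded_mfun_mxP => //; exact: bounded_mfun_mx_cst.
  (* For each sample, the algorithmic error plus the Taylor remainder of exp (tau L_a). *)
  move=> a; rewrite (_ : _ + _ = (F tau a sigma - exp_superop tau (L a) sigma) +
      (exp_superop tau (L a) sigma - (sigma + tau%:C *: L a sigma))); last first.
    by rewrite subrKA scale1r scaleNr opprD addrC addrA.
  apply: trbndD; last by have := trbnd_exp_taylor t0' K0 (bL a) s1; rewrite mulr1.
  apply: trbnd_le (dF a) _; apply: (trbnd_diamond (Phi := fun X => F tau a X - exp_superop tau (L a) X)) hs.
  have lE : linear (exp_superop tau (L a)).
    by apply: (exp_superop_linear (K := 7 * lambda)) => // X; exists (trace_norm X); exact: trbnd_trace_norm.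
  move=> k X Y; rewrite lF lE scalerBr opprD !addrA; congr (_ - _).
  by rewrite addrAC.
have main := trbnd_repeated l0 t0 M1 lS dS sF step hrho.
have -> : cintegral P (fun w =>
    expval O (compose_path (F tau) [seq a_ i w | i <- enum 'I_M] rho)) =
    \tr (O *m iter M Fbar rho).
  rewrite /expval -mxtrace_cintegral; last by move=> i j; exact: (bounded_mfun_path lF mF bF).
  congr (\tr (O *m _)); apply/matrixP => i j; rewrite mxE.
  by rewrite (cintegral_path lF mF bF iid) ?enum_uniq // size_enum_ord.
rewrite /expval -raddfB -mulmxBr TE.
apply: le_trans (main _ _ (spectral_norm_ge0 O) (opbnd_spectral O)) _.
rewrite -/x [leRHS]mulrAC [leRHS]mulrC ler_wpM2l ?spectral_norm_ge0 //.
have MR : 0 < M%:R :> R by rewrite ltr0n.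
have -> : (C0 + 147 * E) * expR 1 * (lambda ^+ 2 * (tau * M%:R) ^+ 2 / M%:R) =
    M%:R * ((C0 + 147 * E) * (lambda ^+ 2 * tau ^+ 2)) * expR 1.
  by field; rewrite gt_eqF.
rewrite ler_pM2r ?expR_gt0 // ler_pM2l //.
have xE : expR x <= E.
  rewrite ler_expR /x mulrCA ler_pM2l //.
  by rewrite -ler_pdivlMr.
have x2 : x ^+ 2 = 49 * (lambda ^+ 2 * tau ^+ 2) by rewrite /x; ring.
have lt0 : 0 <= lambda ^+ 2 * tau ^+ 2 by apply: mulr_ge0; exact: sqr_ge0.
have := ler_wpM2l lt0 xE; rewrite x2; lra.
Qed.
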